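(* Let $n\ge 3$, let $M$ be an $n$-dimensional manifold with coordinates $(x^1,\dots,x^n)$ and induced tangent bundle coordinates $(x^i,y^i)$, let $f=f(x^1)$ be a positive smooth function whose derivative $f'$ is not identically zero, let $(c_{\lambda\mu})_{2\le\lambda,\mu\le n}$ be a non-singular symmetric matrix of real constants, and put $$\beta=f(x^1)\,y^1,\qquad \alpha=f(x^1)\sqrt{(y^1)^2+\varphi},\qquad \varphi=\sum_{\lambda,\mu=2}^n c_{\lambda\mu}y^\lambda y^\mu .$$ Let $p\neq0$ and $q\neq-1$ be real constants, and let $S$ be the spray with coefficients $$G^1=\left(\frac{2f(x^1)^2(y^1)^2-\alpha^2}{2f(x^1)^2}+\frac{q}{2(1+q)}\,\frac{\alpha^2-\beta^2}{f(x^1)^2}\right)\frac{f'(x^1)}{f(x^1)},\qquad G^\mu=P\,y^\mu\quad(\mu=2,\dots,n),$$ where $$P=\left(y^1+\frac{p}{2(1+q)}\,\frac{\sqrt{\alpha^2-\beta^2}}{f(x^1)}\right)\frac{f'(x^1)}{f(x^1)}.$$ If $p^2-4q-4\ne 0$, then $S$ is Finsler metrizable by the (non-regular) Finsler metric $$F=\sqrt{\alpha^2+p\beta\sqrt{\alpha^2-\beta^2}+q\beta^2}\;\exp\!\left(\frac{p}{\sqrt{p^2-4q-4}}\,\operatorname{arctanh}\!\left(\frac{p\beta+2\sqrt{\alpha^2-\beta^2}}{\beta\sqrt{p^2-4q-4}}\right)\right),$$ and $F$ is a Landsberg metric which is not Berwaldian. Moreover, when $p^2-4q-4=0$, the class reduces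 to the class $$F=\left(a\beta+\sqrt{\alpha^2-\beta^2}\right)\exp\!\left(\frac{a\beta}{a\beta+\sqrt{\alpha^2-\beta^2}}\right),\qquad a=\tfrac p2,\quad q=a^2-1,$$ that is, $S$ is then the geodesic spray of this metric.
   Context: Finsler metrics here are non-regular: $F=F(x,y)$ is a function, positively homogeneous of degree $1$ in $y$, considered only on the conic open subset of $TM\setminus\{0\}$ where its defining expression is defined, smooth and nonzero (in particular $\alpha^2-\beta^2>0$), and whose metric tensor $g_{ij}=\frac12\frac{\partial^2F^2}{\partial y^i\partial y^j}$ is non-degenerate there; no definiteness is required (nor for the quadratic form $\alpha^2$). With $(g^{ij})$ the inverse of $(g_{ij})$, the geodesic spray of $F$ is $y^i\frac{\partial}{\partial x^i}-2G^i\frac{\partial}{\partial y^i}$ with coefficients $$G^i=\tfrac14 g^{ih}\left(y^r\frac{\partial^2F^2}{\partial x^r\partial y^h}-\frac{\partial F^2}{\partial x^h}\right).$$ A spray $S=y^i\frac{\partial}{\partial x^i}-2G^i\frac{\partial}{\partial y^i}$ is Finsler metrizable by $F$ if $S$ is the geodesic spray of $F$. The Berwald tensor is $G^h_{ijk}=\frac{\partial^3G^h}{\partial y^i\partial y^j\partial y^k}$ and the Landsberg tensor is $L_{ijk}=-\frac12F\,\ell_h\,G^h_{ijk}$, where $\ell_h=\frac{\partial F}{\partial y^h}$. $F$ is Landsberg if $L_{ijk}\equiv 0$ and Berwald (Berwaldian) if $G^h_{ijk}\equiv0$. Repeated indices are summed. Convention for the formula of $F$: put $\Delta=p^2-4q-4$,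 $w=\sqrt{\alpha^2-\beta^2}$, $N=\alpha^2+p\beta w+q\beta^2$. The function $\operatorname{arctanh} z=\frac12\ln\frac{1+z}{1-z}$ is allowed complex arguments and values (with $\arctan z=-i\operatorname{arctanh}(iz)$), and $F$ is understood up to a nonzero (locally) constant factor, which affects neither the geodesic spray nor the Landsberg and Berwald properties. Concretely, on the region $\beta\ne0$, $N\neq 0$, $F$ is represented by the real function $$\sqrt{|N|}\,\exp\!\left(\frac{p}{2\sqrt{\Delta}}\ln\left|\frac{\beta\sqrt\Delta+p\beta+2w}{\beta\sqrt\Delta-p\beta-2w}\right|\right)\ \text{ if }\Delta>0,\qquad \sqrt{N}\,\exp\!\left(-\frac{p}{\sqrt{-\Delta}}\arctan\frac{p\beta+2w}{\beta\sqrt{-\Delta}}\right)\ \text{ if }\Delta<0 .$$ *)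

(* Defs.v *)
From HB Require Import structures.
From mathcomp Require Export all_boot all_order all_algebra.
From mathcomp Require Export all_classical all_reals all_analysis.
Set Implicit Arguments.
Unset Strict Implicit.
Unset Printing Implicit Defensive.
Import Order.TTheory GRing.Theory Num.Theory.
Import numFieldNormedType.Exports.
Local Open Scope classical_set_scope.
Local Open Scope ring_scope.

Section Smooth.
Variables (R : realType) (V : normedModType R).

(* C^k regularity on an open set D, through directional derivatives. *)
Fixpoint Ck_on (k : nat) (D : set V) (f : V -> R^o) : Prop :=
  match k with
  | 0%N => forall z, D z -> {for z, continuous f}
  | k'.+1 => (forall z, D z -> differentiable f z) /\
             (forall v, Ck_on k' D (fun z => 'D_v f z))
  end.

Definition smooth_on (D : set V) (f : V -> R^o) : Prop :=
  forall k, Ck_on k D f.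

End Smooth.

(* The manifold is an open set U of R^(n+1), and a point of its tangent bundle
   is a pair z = (x, y) : V * V with V = 'rV[R]_n.+1 and x in U.  Coordinate
   index 1 is ord0 : 'I_n.+1, and indices 2, 3, ...
   are the [lift ord0 l], l : 'I_n. *)
Section Finsler.
Variables (R : realType) (n : nat).
Local Notation V := 'rV[R]_n.+1.
Implicit Types (F : V * V -> R^o) (D : set (V * V)) (z : V * V).

Definition ddx (i : 'I_n.+1) F z : R := 'D_((delta_mx 0 i : V), (0 : V)) F z.
Definition ddy (i : 'I_n.+1) F z : R := 'D_((0 : V), (delta_mx 0 i : V)) F z.

Definition sqf F z : R := F z ^+ 2.

Definition metric_tensor F z : 'M[R]_n.+1 :=
  \matrix_(i, j) (2^-1 * ddy i (ddy j (sqf F)) z).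

Definition spray_coef F (i : 'I_n.+1) z : R :=
  4^-1 * \sum_h invmx (metric_tensor F z) i h *
    (\sum_r z.2 0 r * ddx r (ddy h (sqf F)) z - ddx h (sqf F) z).

Definition berwald_tensor (G : 'I_n.+1 -> V * V -> R) (h i j k : 'I_n.+1) z : R :=
  ddy i (ddy j (ddy k (G h))) z.

Definition landsberg_tensor F (i j k : 'I_n.+1) z : R :=
  - 2^-1 * F z * \sum_h ddy h F z * berwald_tensor (spray_coef F) h i j k z.

(* Non-regular Finsler metric with conic domain D: no positivity of F and no
   definiteness of the metric tensor. *)
Record finsler_metric (D : set (V * V)) (F : V * V -> R) : Prop := {
  fm_open : open D;
  fm_nonempty : D !=set0;
  fm_slit : forall z, D z -> z.2 != 0;
  fm_conic : forall (x y : V) (t : R), 0 < t -> D (x, y) -> D (x, t *: y);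
  fm_smooth : smooth_on D F;
  fm_neq0 : forall z, D z -> F z != 0;
  fm_homog : forall (x y : V) (t : R), 0 < t -> D (x, y) ->
    F (x, t *: y) = t * F (x, y);
  fm_nondeg : forall z, D z -> metric_tensor F z \in unitmx
}.

(* A spray y^i d/dx^i - 2 G^i d/dy^i is given by its coefficients G^i. *)
Definition metrizable_by D (G : 'I_n.+1 -> V * V -> R) F : Prop :=
  finsler_metric D F /\ forall z i, D z -> G i z = spray_coef F i z.

Definition landsberg D F : Prop :=
  forall z i j k, D z -> landsberg_tensor F i j k z = 0.

Definition berwald D F : Prop :=
  forall z h i j k, D z -> berwald_tensor (spray_coef F) h i j k z = 0.

End Finsler.

Section LandsbergClass.
Variables (R : realType) (n : nat).
Local Notation V := 'rV[R]_n.+1.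
Variables (f : R -> R) (c : 'M[R]_n).
Implicit Types (p q a : R) (U : set V) (x y : V) (z : V * V).

Definition x1 x : R := x 0 ord0.

Definition phi y : R :=
  \sum_(l < n) \sum_(m < n) c l m * y 0 (lift ord0 l) * y 0 (lift ord0 m).

Definition beta z : R := f (x1 z.1) * z.2 0 ord0.

(* Num.sqrt is 0 on negative reals, so that alpha ^+ 2 - beta ^+ 2 > 0
   forces (y^1)^2 + phi > 0. *)
Definition alpha z : R := f (x1 z.1) * Num.sqrt (z.2 0 ord0 ^+ 2 + phi z.2).

Definition w z : R := Num.sqrt (alpha z ^+ 2 - beta z ^+ 2).

Definition NN p q z : R := alpha z ^+ 2 + p * beta z * w z + q * beta z ^+ 2.

Definition PP p q z : R :=
  (z.2 0 ord0 + p / (2 * (1 + q)) * (w z / f (x1 z.1)))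
  * (derive1 f (x1 z.1) / f (x1 z.1)).

Definition S_coef p q (i : 'I_n.+1) z : R :=
  if i == ord0 then
    ((2 * f (x1 z.1) ^+ 2 * z.2 0 ord0 ^+ 2 - alpha z ^+ 2)
       / (2 * f (x1 z.1) ^+ 2)
     + q / (2 * (1 + q)) * ((alpha z ^+ 2 - beta z ^+ 2) / f (x1 z.1) ^+ 2))
    * (derive1 f (x1 z.1) / f (x1 z.1))
  else PP p q z * z.2 0 i.

Definition Delta p q : R := p ^+ 2 - 4 * q - 4.

(* Real representative, up to a locally constant factor, of
   sqrt N * exp (p / sqrt Delta * arctanh ((p beta + 2 w) / (beta sqrt Delta))),
   where arctanh t = ln ((1 + t) / (1 - t)) / 2 and arctanh (- 'i t) = - 'i atan t.
   Only used for Delta p q != 0. *)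
Definition F_main p q z : R :=
  if 0 < Delta p q then
    let d := Num.sqrt (Delta p q) in
    Num.sqrt `|NN p q z| *
    expR (p / (2 * d) *
      ln `|(beta z * d + p * beta z + 2 * w z)
           / (beta z * d - p * beta z - 2 * w z)|)
  else
    let d := Num.sqrt (- Delta p q) in
    Num.sqrt (NN p q z) *
    expR (- (p / d) * atan ((p * beta z + 2 * w z) / (beta z * d))).

Definition dom_main U p q : set (V * V) :=
  [set z | [/\ U z.1, 0 < alpha z ^+ 2 - beta z ^+ 2,
               beta z != 0 & NN p q z != 0]].

Definition F_degen a z : R :=
  (a * beta z + w z) * expR (a * beta z / (a * beta z + w z)).

Definition dom_degen U a : set (V * V) :=
  [set z | [/\ U z.1, 0 < alpha z ^+ 2 - beta z ^+ 2 &
               a * beta z + w z != 0]].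

End LandsbergClass.

(* Main.v *)
Require Import Defs.
From HB Require Import structures.
From mathcomp Require Import ring lra.
Set Implicit Arguments.
Unset Strict Implicit.
Unset Printing Implicit Defensive.
Import Order.TTheory GRing.Theory Num.Theory.
Import numFieldNormedType.Exports.
Local Open Scope classical_set_scope.
Local Open Scope ring_scope.

(** Write u = y^1, s = sqrt phi, k = 1 + q and N = phi + p u s + k u^2. Since
    alpha^2 - beta^2 = f^2 phi, every ingredient is f(x^1) to some power times
    a function of (u, s): beta = f u, w = f s, NN = f^2 N.  So F = f Phi(u, s)
    with Phi homogeneous of degree one, and the particular shape of Phi enters
    only through its logarithmic differential.  With
    [m(v) = (p s + k u) v^1 + <y, v>], where [< , >] is the polar form of phi,
    [[ dF(v) = F (f'/f dx^1(v) + m(dy(v)) / N). ]]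
    Both the generic metric (for either sign of Delta) and the degenerate one
    satisfy this equation: see [F_main_dlog] and [F_degen_dlog].  In the
    generic case it amounts to [T'(t) = - p / (2 (t^2 + p t + k))] for the
    exponent T as a function of t = s / u.

    Everything else follows from this equation alone, on any open set D where
    phi > 0 and N, F do not vanish (lemmas [dlog_...] and their auxiliaries).

    Smoothness: a differentiable function whose logarithmic derivatives are
    smooth is smooth ([Ck_log_derivative]).

    Metric: differentiating F^2 twice gives an explicit bilinear form
    ([metric_form]); it sends y to (F^2 / N) m, so a vector v in its kernel has
    m(v) = 0, which leaves k v^1 = 0 and c v = 0, hence v = 0.

    Spray: by homogeneity the candidate
    [G = f'/f ((u + p s / (2 k)) y - N / (2 k) e_1)] only has to be paired with
    the metric, and g(y, .), g(e_1, .) are known; this G is the stated spray.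

    Landsberg: in G^h only the term [s y^h] with h >= 2 is not quadratic in y,
    and it is contracted with dF/dy^h = F <y, e_h> / N.  The sum of the
    [<y, e_h> (s y^h)_ijk] is
    [s^2 s_ijk + s s_i s_jk + s s_j s_ik + s s_k s_ij], which is s times the
    third derivative of s^2 / 2 = phi / 2, that is 0.

    Not Berwald: the trace of the Berwald tensor is a nonzero multiple of
    [f'/f p s_jk]; if it vanished where f' <> 0, then c would be the rank one
    matrix of the products s_j s_k, impossible for an invertible c of size at
    least 2. *)

(** * Differentials of real functions on a normed space *)

Section Differentials.
Variables (R : realType) (W : normedModType R).
Implicit Types (f g df dg : W -> R) (z v : W).

Lemma is_diff_dir f df z v : is_diff z f df -> 'D_v f z = df v.
Proof. by case=> fz dfE; rewrite deriveE// dfE. Qed.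

Lemma is_diff_ext f g df dg z : is_diff z f df ->
  (forall y, f y = g y) -> (forall v, df v = dg v) -> is_diff z g dg.
Proof. by move=> H /funext <- /funext <-. Qed.

(** Differentials are local: the formulas for F below hold only on an open
    domain, and are differentiated there. *)
Lemma near_eq_is_diff f g df z :
  (\near z, f z = g z) -> is_diff z f df -> is_diff z g df.
Proof.
move=> fg [fz dfE].
have [dfc fo] := (diff_locallyP z f).1 fz.
have go : g \o shift z = cst (g z) + 'd f z +o_ 0 id.
  apply/eqaddoP => e e0.
  have /eqaddoP/(_ e e0) fe := fo.
  have fg0 : \forall h \near 0, f (h + z) = g (h + z).
    have := fg; rewrite (near_shift 0).
    by apply: filterS => h /=; rewrite subr0.
  near=> h.
  rewrite !fctE /= -(near fg0 h)//.
  by rewrite -(nbhs_singleton fg); near: h; exact: fe.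
have dE := diff_unique dfc go.
by split; [apply/diff_locallyP; rewrite dE|rewrite dE dfE].
Unshelve. all: by end_near. Qed.

Lemma is_diff_const (a : R) z : is_diff z (fun=> a) (fun=> 0).
Proof. exact: is_diff_cst. Qed.

Lemma is_diff_add f g df dg z : is_diff z f df -> is_diff z g dg ->
  is_diff z (fun y => f y + g y) (fun v => df v + dg v).
Proof. exact: is_diffD. Qed.

Lemma is_diff_mul f g df dg z : is_diff z f df -> is_diff z g dg ->
  is_diff z (fun y => f y * g y) (fun v => f z * dg v + g z * df v).
Proof. exact: is_diffM. Qed.

Lemma is_diff_sum n (f df : 'I_n -> W -> R) z :
  (forall i, is_diff z (f i) (df i)) ->
  is_diff z (fun y => \sum_(i < n) f i y) (fun v => \sum_(i < n) df i v).
Proof.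
move=> fi; elim: n f df fi => [|n IH] f df fi.
  have -> : (fun y => \sum_(i < 0) f i y) = cst 0.
    by apply/funext => y; rewrite big_ord0.
  have -> : (fun y => \sum_(i < 0) df i y) = 0.
    by apply/funext => y; rewrite big_ord0.
  exact: is_diff_cst.
have -> : (fun y => \sum_(i < n.+1) f i y) =
    (fun y => \sum_(i < n) f (widen_ord (leqnSn n) i) y + f ord_max y).
  by apply/funext => y; rewrite big_ord_recr.
have -> : (fun y => \sum_(i < n.+1) df i y) =
    (fun y => \sum_(i < n) df (widen_ord (leqnSn n) i) y + df ord_max y).
  by apply/funext => y; rewrite big_ord_recr.
by apply: is_diff_add => //; apply: IH => i.
Qed.

Lemma is_diff_chain (h : R -> R) f df z l : is_diff z f df ->
  is_derive (f z) 1 h l -> is_diff z (fun y => h (f y)) (fun v => l * df v).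
Proof.
move=> fz [/derivable1_diffP hd hl].
have hz : is_diff (f z) h (fun t => t * l).
  by split=> //; rewrite diff1E// derive1E hl.
have [? E] := is_diff_comp fz hz.
by split=> //; rewrite E; apply/funext => v /=; rewrite mulrC.
Qed.

End Differentials.

(** * Smoothness on open sets *)

Section SmoothFunctions.
Variables (R : realType) (W : normedModType R).
Implicit Types (D : set W) (f g : W -> R).

Lemma open_near D z (P : W -> Prop) :
  open D -> D z -> (forall y, D y -> P y) -> \forall y \near z, P y.
Proof. by move=> Do Dz DP; apply: filterS (open_nbhs_nbhs (conj Do Dz)). Qed.

Lemma Ck_ext k D f g : open D -> (forall z, D z -> f z = g z) ->
  Ck_on k D f -> Ck_on k D g.
Proof.
move=> Do; elim: k f g => [|k IH] f g fg /=.
  move=> fc z Dz; have fgz := open_near Do Dz fg.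
  have := fc z Dz; rewrite /prop_for /continuous_at (fg _ Dz).
  by apply: cvg_trans; apply: near_eq_cvg.
case=> fd fD; split=> [z Dz|v].
  by case: (near_eq_is_diff (open_near Do Dz fg) (differentiableP (fd z Dz))).
apply: IH (fD v) => z Dz.
exact: near_eq_derive (open_near Do Dz fg).
Qed.

Lemma Ck_le k D f : Ck_on k.+1 D f -> Ck_on k D f.
Proof.
elim: k f => [|k IH] f [fd fD]; first by move=> z /fd/differentiable_continuous.
by split=> // v; apply: IH; exact: fD.
Qed.

(** The induction step of every closure property: the partial derivatives need
    only be computed on the open set D, by any formula. *)
Lemma Ck_step k D f (df : W -> W -> R) : open D ->
  (forall z, D z -> is_diff z f (df z)) -> (forall v, Ck_on k D (df ^~ v)) ->
  Ck_on k.+1 D f.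
Proof.
move=> Do fd fD; split=> [z /fd[]//|v].
by apply: Ck_ext Do _ (fD v) => z Dz; rewrite (is_diff_dir v (fd z Dz)).
Qed.

Lemma Ck_diff k D f z : Ck_on k.+1 D f -> D z ->
  is_diff z f (fun v => 'D_v f z).
Proof.
move=> [fd _] Dz; split; first exact: fd.
by apply/funext => v; rewrite deriveE//; exact: fd.
Qed.

Lemma Ck_cst k D (a : R) : open D -> Ck_on k D (fun=> a).
Proof.
move=> Do; elim: k a => [|k IH] a; first by move=> z _; exact: cst_continuous.
by apply: (@Ck_step _ _ _ (fun _ _ => 0)) => // z _; exact: is_diff_cst.
Qed.

Lemma Ck_D k D f g : open D -> Ck_on k D f -> Ck_on k D g ->
  Ck_on k D (fun z => f z + g z).
Proof.
move=> Do; elim: k f g => [|k IH] f g fk gk.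
  by move=> z Dz; apply: continuousD; [exact: fk|exact: gk].
apply: (@Ck_step _ _ _ (fun z v => 'D_v f z + 'D_v g z)) => // [z Dz|v].
  by apply: is_diff_add; [exact: Ck_diff fk Dz|exact: Ck_diff gk Dz].
by apply: IH; [exact: fk.2|exact: gk.2].
Qed.

Lemma Ck_M k D f g : open D -> Ck_on k D f -> Ck_on k D g ->
  Ck_on k D (fun z => f z * g z).
Proof.
move=> Do; elim: k f g => [|k IH] f g fk gk.
  by move=> z Dz; apply: continuousM; [exact: fk|exact: gk].
apply: (@Ck_step _ _ _ (fun z v => f z * 'D_v g z + g z * 'D_v f z)) => //.
  by move=> z Dz; apply: is_diff_mul;
    [exact: Ck_diff fk Dz|exact: Ck_diff gk Dz].
move=> v; apply: Ck_D => //; apply: IH; try exact: Ck_le.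
- exact: gk.2.
- exact: fk.2.
Qed.

Lemma Ck_sum k D n (f : 'I_n -> W -> R) : open D ->
  (forall i, Ck_on k D (f i)) -> Ck_on k D (fun z => \sum_(i < n) f i z).
Proof.
move=> Do fk; elim: n f fk => [|n IH] f fk.
  by apply: Ck_ext Do _ (Ck_cst k 0 Do) => z _; rewrite big_ord0.
have := Ck_D Do (IH _ (fun i => fk (widen_ord (leqnSn n) i))) (fk ord_max).
by apply: Ck_ext => // z _; rewrite big_ord_recr.
Qed.

Lemma Ck_linear k D f : open D ->
  (forall z, is_diff z f f) -> Ck_on k D f.
Proof.
move=> Do fl; case: k => [|k].
  by move=> z _; apply: differentiable_continuous; case: (fl z).
by apply: (@Ck_step _ _ _ (fun _ v => f v)) => // v; exact: Ck_cst.
Qed.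

(** A linear differential equation bootstraps regularity: the derivatives of f
    are f itself times smooth functions. *)
Lemma Ck_log_derivative k D f (l : W -> W -> R) : open D ->
  (forall z, D z -> is_diff z f (fun v => f z * l z v)) ->
  (forall v, smooth_on D (l ^~ v)) -> Ck_on k D f.
Proof.
move=> Do fd ls; elim: k => [|k IH].
  by move=> z /fd[/differentiable_continuous].
apply: (@Ck_step _ _ _ (fun z v => f z * l z v)) => // v.
by apply: Ck_M => //; exact: ls.
Qed.

Lemma Ck_comp k D (E : set R) (h : R -> R) f : open D ->
  (forall z, D z -> E (f z)) -> Ck_on k E h -> Ck_on k D f ->
  Ck_on k D (fun z => h (f z)).
Proof.
move=> Do DE; elim: k h f DE => [|k IH] h f DE hk fk.
  by move=> z Dz; apply: continuous_comp; [exact: fk|exact: hk (DE _ Dz)].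
apply: (@Ck_step _ _ _ (fun z v => 'D_1 h (f z) * 'D_v f z)) => // [z Dz|v].
  apply: is_diff_chain (Ck_diff fk Dz) _.
  by split=> //; apply/derivable1_diffP; exact: hk.1 (DE _ Dz).
apply: Ck_M => //; last exact: fk.2.
by apply: (IH (fun x => 'D_1 h x)) => //; [exact: hk.2|exact: Ck_le].
Qed.

End SmoothFunctions.

Section SmoothRealFunctions.
Variable R : realType.

Lemma is_diff_inv (W : normedModType R) (f df : W -> R) z : f z != 0 ->
  is_diff z f df ->
  is_diff z (fun y => (f y)^-1) (fun v => - (f z ^- 2) * df v).
Proof.
move=> fz0 [fd dfE]; split; first exact: differentiableV.
by rewrite diffV// dfE.
Qed.

Lemma smooth_inv : smooth_on [set x : R | x != 0] (@GRing.inv R).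
Proof.
elim=> [|k IH]; first by move=> x /= x0; exact: inv_continuous.
have No : open [set x : R | x != 0].
  exact: open_neq.
apply: (Ck_step (df := fun x v : R => - (x^-1 * x^-1) * v) No).
  move=> x x0; have := is_diff_inv x0 (is_diff_id x).
  by rewrite expr2 invfM.
move=> v; apply: Ck_M => //; last exact: Ck_cst.
apply: (Ck_ext (f := fun x : R => -1 * (x^-1 * x^-1)) No).
  by move=> x _; rewrite mulN1r.
by apply: Ck_M => //; [exact: Ck_cst|exact: Ck_M].
Qed.

Lemma smooth_sqrt : smooth_on [set x : R | 0 < x] (@Num.sqrt R).
Proof.
elim=> [|k IH]; first by move=> x _; exact: sqrt_continuous.
have Po : open [set x : R | 0 < x] by exact: open_gt.
apply: (Ck_step (df := fun x v : R => 2^-1 * (Num.sqrt x * x^-1) * v) Po).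
  move=> x /= x0.
  have := is_diff_chain (is_diff_id x) (is_derive1_sqrt x0).
  rewrite (_ : 2^-1 * _ = (2 * Num.sqrt x)^-1)//.
  by rewrite -{2}(sqr_sqrtr (ltW x0)); field; rewrite sqrtr_eq0 -ltNge.
move=> v; apply: Ck_M => //; last exact: Ck_cst.
apply: Ck_M => //; first exact: Ck_cst.
apply: Ck_M => //; apply: Ck_comp (smooth_inv k) _ => //.
  by move=> x /= /gt_eqF ->.
by apply: Ck_linear => // x; exact: is_diff_id.
Qed.

End SmoothRealFunctions.

(** * Coordinates and the polar form of phi *)

Section Coordinates.
Variables (R : realType) (n : nat).
Local Notation V := 'rV[R]_n.+1.
Implicit Types (z v : V * V) (y a b : V).

Definition evec (i : 'I_n.+1) : V := delta_mx 0 i.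

Lemma evec00 : evec ord0 0 ord0 = 1.
Proof. by rewrite mxE. Qed.

(** Coordinates are continuous linear forms, hence their own differentials. *)
Lemma is_diff_x i z : is_diff z (fun z => z.1 0 i) (fun v => v.1 0 i).
Proof.
have lf : linear (fun v : V * V => v.1 0 i : R^o).
  by move=> a u v; rewrite !mxE.
pose L : {linear (V * V)%type -> R^o} :=
  HB.pack (fun v : V * V => v.1 0 i : R^o) (GRing.isLinear.Build _ _ _ _ _ lf).
have cL : continuous L.
  move=> v; apply: (@continuous_comp _ _ _ fst (fun v : V => v 0 i)).
    exact: cvg_fst.
  exact: coord_continuous.
by split; [exact: (linear_differentiable z cL)|exact: (diff_lin z cL)].
Qed.

Lemma is_diff_y i z : is_diff z (fun z => z.2 0 i) (fun v => v.2 0 i).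
Proof.
have lf : linear (fun v : V * V => v.2 0 i : R^o).
  by move=> a u v; rewrite !mxE.
pose L : {linear (V * V)%type -> R^o} :=
  HB.pack (fun v : V * V => v.2 0 i : R^o) (GRing.isLinear.Build _ _ _ _ _ lf).
have cL : continuous L.
  move=> v; apply: (@continuous_comp _ _ _ snd (fun v : V => v 0 i)).
    exact: cvg_snd.
  exact: coord_continuous.
by split; [exact: (linear_differentiable z cL)|exact: (diff_lin z cL)].
Qed.

Lemma sum_evec (L : V -> R) (v : V) :
  (forall k a b, L (k *: a + b) = k * L a + L b) ->
  \sum_i L (evec i) * v 0 i = L v.
Proof.
move=> Ll; have L0 : L 0 = 0.
  by have := Ll (-1) 0 0; rewrite scaler0 addr0; lra.
have LD : {morph L : a b / a + b}.
  by move=> a b; rewrite -[a]scale1r Ll mul1r scale1r.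
rewrite [in RHS](row_sum_delta v) (big_morph L LD L0).
by apply: eq_bigr => i _; rewrite -[_ *: _]addr0 Ll L0 addr0 mulrC.
Qed.

Lemma sum_evec0 (v : V) : \sum_i evec i 0 ord0 * v 0 i = v 0 ord0.
Proof.
by have := @sum_evec (fun w => w 0 ord0) v; apply=> k a b; rewrite !mxE.
Qed.

Variable c : 'M[R]_n.

(** The polar form of phi, as a degenerate form on the whole space: keeping the
    first coordinate, on which it vanishes, lets the tensor formulas below run
    over all indices without splitting off the index 1. *)
Definition bil (a b : V) : R :=
  \sum_(l < n) \sum_(m < n) c l m * a 0 (lift ord0 l) * b 0 (lift ord0 m).

Lemma bilDZl b k a a' : bil (k *: a + a') b = k * bil a b + bil a' b.
Proof.
rewrite /bil mulr_sumr -big_split; apply: eq_bigr => l _ /=.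
by rewrite mulr_sumr -big_split; apply: eq_bigr => m _ /=; rewrite !mxE; ring.
Qed.

Lemma bilDZr b k a a' : bil b (k *: a + a') = k * bil b a + bil b a'.
Proof.
rewrite /bil mulr_sumr -big_split; apply: eq_bigr => l _ /=.
by rewrite mulr_sumr -big_split; apply: eq_bigr => m _ /=; rewrite !mxE; ring.
Qed.

Lemma bil0l b : bil 0 b = 0.
Proof. by have := bilDZl b (-1) 0 0; rewrite scaler0 addr0; lra. Qed.

Lemma bil0r b : bil b 0 = 0.
Proof. by have := bilDZr b (-1) 0 0; rewrite scaler0 addr0; lra. Qed.

Lemma bilC : c^T = c -> forall a b, bil a b = bil b a.
Proof.
move=> cs a b; rewrite /bil exchange_big; apply: eq_bigr => l _ /=.
apply: eq_bigr => m _; rewrite -[in RHS]cs mxE; ring.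
Qed.

Lemma bil_evec0l b : bil (evec ord0) b = 0.
Proof.
rewrite /bil big1// => l _; rewrite big1// => m _.
by rewrite !mxE eqxx/= mulr0 mul0r.
Qed.

Lemma bil_evec0r b : bil b (evec ord0) = 0.
Proof.
by rewrite /bil big1// => l _; rewrite big1// => m _; rewrite !mxE eqxx/= mulr0.
Qed.

Lemma bil_evec l m : bil (evec (lift ord0 l)) (evec (lift ord0 m)) = c l m.
Proof.
rewrite /bil (bigD1 l)//= (bigD1 m)//= big1 ?addr0; last first.
  move=> i im; rewrite !mxE !eqxx/= (inj_eq lift_inj) (negbTE im).
  by rewrite mulr0.
rewrite big1 ?addr0 => [|i il]; first by rewrite !mxE !eqxx !mulr1.
apply: big1 => j _; rewrite !mxE/= (inj_eq lift_inj) (negbTE il).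
by rewrite mulr0 mul0r.
Qed.

Lemma bil_evecl l b :
  bil (evec (lift ord0 l)) b = \sum_m c l m * b 0 (lift ord0 m).
Proof.
rewrite /bil (bigD1 l)//= [X in _ + X]big1 ?addr0 => [|i il].
  by apply: eq_bigr => m _; rewrite !mxE !eqxx mulr1.
apply: big1 => j _; rewrite !mxE/= (inj_eq lift_inj) (negbTE il).
by rewrite mulr0 mul0r.
Qed.

Lemma bil_nondeg (v : V) : c \in unitmx -> v 0 ord0 = 0 ->
  (forall i, bil (evec i) v = 0) -> v = 0.
Proof.
move=> cu v0 bv; pose v' : 'cV[R]_n := \col_m v 0 (lift ord0 m).
have cv : c *m v' = 0.
  apply/colP => l; rewrite !mxE -[RHS](bv (lift ord0 l)) bil_evecl.
  by apply: eq_bigr => m _; rewrite mxE.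
have v'0 : v' = 0 by rewrite -[v'](mulKmx cu) cv mulmx0.
apply/rowP => i; rewrite mxE; have [j|] := unliftP ord0 i => [->|->//].
by have /colP/(_ j) := v'0; rewrite !mxE.
Qed.

Lemma phi_bil y : phi c y = bil y y. Proof. by []. Qed.

Lemma is_diff_bil b z :
  is_diff z (fun z => bil z.2 b) (fun v => bil v.2 b).
Proof.
apply: is_diff_sum => l; apply: is_diff_sum => m.
apply: is_diff_eq (is_diff_mul (is_diff_mul (is_diff_const (c l m) z)
  (is_diff_y (lift ord0 l) z)) (is_diff_const (b 0 (lift ord0 m)) z)) _.
by apply/funext => v /=; rewrite mulr0 add0r; ring.
Qed.

Hypothesis c_sym : c^T = c.

Lemma is_diff_phi z : is_diff z (fun z => phi c z.2) (fun v => 2 * bil z.2 v.2).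
Proof.
have H : is_diff z (fun z => phi c z.2) (fun v => bil z.2 v.2 + bil v.2 z.2).
  rewrite (_ : (fun v => bil z.2 v.2 + _) = (fun v : V * V =>
    \sum_(l < n) \sum_(m < n)
    (c l m * z.2 0 (lift ord0 l) * v.2 0 (lift ord0 m) +
     z.2 0 (lift ord0 m) * (c l m * v.2 0 (lift ord0 l))))); last first.
    apply/funext => v /=; rewrite /bil -big_split; apply: eq_bigr => l _ /=.
    by rewrite -big_split; apply: eq_bigr => m _ /=; ring.
  apply: is_diff_sum => l; apply: is_diff_sum => m.
  apply: is_diff_eq (is_diff_mul (is_diff_mul (is_diff_const (c l m) z)
    (is_diff_y (lift ord0 l) z)) (is_diff_y (lift ord0 m) z)) _.
  by apply/funext => v /=; rewrite mulr0 addr0.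
by apply: is_diff_eq H _; apply/funext => v; rewrite (bilC c_sym v.2); ring.
Qed.

End Coordinates.

(** * The functions s, N and m of the fibre variables *)

Section SphericalFactor.
Variables (R : realType) (n : nat) (c : 'M[R]_n) (p q : R).
Hypothesis c_sym : c^T = c.
Local Notation V := 'rV[R]_n.+1.
Local Notation k := (1 + q).
Implicit Types (z v : V * V) (a b : V).

(** These are w, NN and the fibre part of d log F with the powers of the
    conformal factor f divided out, so that they depend on y only. *)
Definition rad z : R := Num.sqrt (phi c z.2).
Definition redN z : R :=
  phi c z.2 + p * z.2 0 ord0 * rad z + k * z.2 0 ord0 ^+ 2.
Definition redm z a : R :=
  (p * rad z + k * z.2 0 ord0) * a 0 ord0 + bil c z.2 a.

Local Notation s := rad.
Local Notation N := redN.
Local Notation m := redm.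
Local Notation u z := (z.2 0 ord0).

Lemma rad_gt0 z : 0 < phi c z.2 -> 0 < s z.
Proof. by rewrite sqrtr_gt0. Qed.

Lemma rad_neq0 z : 0 < phi c z.2 -> s z != 0.
Proof. by move=> /rad_gt0/gt_eqF->. Qed.

Lemma rad_sq z : 0 < phi c z.2 -> phi c z.2 = s z ^+ 2.
Proof. by move=> h; rewrite sqr_sqrtr// ltW. Qed.

Lemma bil_rad z : 0 < phi c z.2 -> bil c z.2 z.2 = s z ^+ 2.
Proof. by move=> h; rewrite -phi_bil rad_sq. Qed.

Lemma is_diff_rad z : 0 < phi c z.2 ->
  is_diff z s (fun v => bil c z.2 v.2 / s z).
Proof.
move=> z0; have s0 := rad_neq0 z0.
apply: is_diff_eq (is_diff_chain (is_diff_phi c_sym z) (is_derive1_sqrt z0)) _.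
by apply/funext => v; rewrite -/(s z); field.
Qed.

Lemma is_diff_redN z : 0 < phi c z.2 ->
  is_diff z N (fun v => 2 * bil c z.2 v.2
    + p * (u z * (bil c z.2 v.2 / s z) + s z * u v) + 2 * k * u z * u v).
Proof.
move=> z0.
apply: is_diff_eq (is_diff_add (is_diff_add (is_diff_phi c_sym z)
  (is_diff_mul (is_diff_mul (is_diff_const p z) (is_diff_y ord0 z))
     (is_diff_rad z0)))
  (is_diff_mul (is_diff_const k z)
     (is_diff_mul (is_diff_y ord0 z) (is_diff_y ord0 z)))) _.
by apply/funext => v; ring.
Qed.

Lemma is_diff_redm z b : 0 < phi c z.2 ->
  is_diff z (m ^~ b) (fun v =>
    (p * (bil c z.2 v.2 / s z) + k * u v) * b 0 ord0 + bil c v.2 b).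
Proof.
move=> z0.
apply: is_diff_eq (is_diff_add (is_diff_mul
  (is_diff_add (is_diff_mul (is_diff_const p z) (is_diff_rad z0))
     (is_diff_mul (is_diff_const k z) (is_diff_y ord0 z)))
  (is_diff_const (b 0 ord0) z)) (is_diff_bil c b z)) _.
by apply/funext => v; ring.
Qed.

Lemma redmDZ z t a b : m z (t *: a + b) = t * m z a + m z b.
Proof. by rewrite /redm bilDZr !mxE; ring. Qed.

Lemma redm_self z : 0 < phi c z.2 -> m z z.2 = N z.
Proof. by move=> z0; rewrite /redm /redN phi_bil; ring. Qed.

Lemma Ck_u j (D : set (V * V)) : open D -> Ck_on j D (fun z => u z).
Proof. by move=> Do; apply: Ck_linear => // z; exact: is_diff_y. Qed.

Lemma Ck_bil j (D : set (V * V)) b : open D -> Ck_on j D (fun z => bil c z.2 b).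
Proof. by move=> Do; apply: Ck_linear => // z; exact: is_diff_bil. Qed.

Lemma Ck_phi j (D : set (V * V)) : open D -> Ck_on j D (fun z => phi c z.2).
Proof.
move=> Do; have y_smooth i : Ck_on j D (fun z => z.2 0 i).
  by apply: Ck_linear => // z; exact: is_diff_y.
apply: Ck_sum => // l; apply: Ck_sum => // i.
by apply: Ck_M => //; apply: Ck_M => //; exact: Ck_cst.
Qed.

Lemma Ck_rad j (D : set (V * V)) : open D -> (forall z, D z -> 0 < phi c z.2) ->
  Ck_on j D s.
Proof.
move=> Do Dp.
apply: (@Ck_comp _ _ j D _ _ (fun z => phi c z.2) Do Dp (@smooth_sqrt R j)).
exact: Ck_phi.
Qed.

Lemma Ck_redN j (D : set (V * V)) : open D ->
  (forall z, D z -> 0 < phi c z.2) ->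
  Ck_on j D N.
Proof.
move=> Do Dp; apply: Ck_D => //; last first.
  apply: Ck_M => //; first exact: Ck_cst.
  by apply: Ck_M => //; exact: Ck_u.
apply: Ck_D => //; first exact: Ck_phi.
apply: Ck_M => //; last exact: Ck_rad.
by apply: Ck_M => //; [exact: Ck_cst|exact: Ck_u].
Qed.

Lemma Ck_redm j (D : set (V * V)) b : open D ->
  (forall z, D z -> 0 < phi c z.2) -> Ck_on j D (m ^~ b).
Proof.
move=> Do Dp; apply: Ck_D => //; last exact: Ck_bil.
apply: Ck_M => //; last exact: Ck_cst.
apply: Ck_D => //; apply: Ck_M => //; try exact: Ck_cst.
- exact: Ck_rad.
- exact: Ck_u.
Qed.

End SphericalFactor.

(** * Geometry of a function with prescribed logarithmic differential *)

Section ScaledMetric.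
Variables (R : realType) (n : nat) (U : set 'rV[R]_n.+1) (f : R -> R).
Variables (c : 'M[R]_n) (p q : R).
Local Notation V := 'rV[R]_n.+1.
Hypothesis f_smooth : smooth_on (@x1 R n @` U) f.
Hypothesis f_pos : forall x, U x -> 0 < f (x1 x).
Hypotheses (c_sym : c^T = c) (c_nonsing : c \in unitmx).
Hypotheses (q1 : 1 + q != 0).
Variables (D : set (V * V)) (F : V * V -> R).
Hypothesis Do : open D.
Hypothesis DU : forall z, D z -> U z.1.
Hypothesis Dphi : forall z, D z -> 0 < phi c z.2.
Hypothesis DN : forall z, D z -> redN c p q z != 0.

Local Notation k := (1 + q).
Local Notation u z := (z.2 0 ord0).
Local Notation s := (rad c).
Local Notation N := (redN c p q).
Local Notation m := (redm c p q).
Local Notation B := (bil c).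
Implicit Types (z v : V * V) (a b : V).

Definition tau z : R := derive1 f (x1 z.1) / f (x1 z.1).

(** F stands for either of the two metrics: both solve this equation, and all
    their geometry is drawn from it. *)
Hypothesis F_neq0 : forall z, D z -> F z != 0.
Hypothesis F_dlog : forall z, D z ->
  is_diff z F (fun v => F z * (tau z * v.1 0 ord0 + m z v.2 / N z)).

Lemma Ck_f j : Ck_on j D (fun z => f (x1 z.1)).
Proof.
apply: Ck_comp Do _ (f_smooth j) _ => [z /DU Uz|]; first by exists z.1.
by apply: Ck_linear => // z; exact: is_diff_x.
Qed.

Lemma Ck_tau j : Ck_on j D tau.
Proof.
have f'_smooth : Ck_on j D (fun z => derive1 f (x1 z.1)).
  apply: (@Ck_ext _ _ _ _ (fun z => 'D_1 f (x1 z.1))) => //.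
    by move=> z _; rewrite derive1E.
  apply: (@Ck_comp _ _ _ _ _ (fun x => 'D_1 f x)) Do _ ((f_smooth j.+1).2 1) _.
    by move=> z /DU Uz; exists z.1.
  by apply: Ck_linear => // z; exact: is_diff_x.
apply: Ck_M => //; apply: Ck_comp Do _ (smooth_inv R j) (Ck_f j).
by move=> z /DU/f_pos/gt_eqF /= ->.
Qed.

Lemma dlog_smooth : smooth_on D F.
Proof.
move=> j; apply: Ck_log_derivative Do F_dlog _ => v i.
apply: Ck_D => //; apply: Ck_M => //.
- exact: Ck_tau.
- exact: Ck_cst.
- exact: Ck_redm.
- by apply: Ck_comp Do DN (smooth_inv R i) _; exact: Ck_redN.
Qed.

(** Half the vertical derivative of F^2 is [metric_factor * redm]. *)
Definition metric_factor z := F z ^+ 2 / N z.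
Local Notation K := metric_factor.

Lemma metric_factor_neq0 z : D z -> K z != 0.
Proof. by move=> Dz; rewrite mulf_neq0 ?invr_neq0 ?expf_neq0 ?F_neq0 ?DN. Qed.

Lemma is_diff_sqF z : D z -> is_diff z (sqf F)
  (fun v => 2 * F z ^+ 2 * tau z * v.1 0 ord0 + 2 * K z * m z v.2).
Proof.
move=> Dz; apply: is_diff_eq (is_diff_mul (F_dlog Dz) (F_dlog Dz)) _.
by apply/funext => v; rewrite /metric_factor; ring.
Qed.

Lemma is_diff_metric_factor z : D z -> is_diff z K (fun v => K z *
  (2 * tau z * v.1 0 ord0 + p / N z * (s z * u v - u z / s z * B z.2 v.2))).
Proof.
move=> Dz; have N0 := DN Dz; have s0 := rad_neq0 (Dphi Dz).
apply: is_diff_eq (is_diff_mul (is_diff_mul (F_dlog Dz) (F_dlog Dz))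
  (is_diff_inv N0 (is_diff_redN p q c_sym (Dphi Dz)))) _.
apply/funext => v; rewrite /metric_factor /redm.
by field; rewrite s0.
Qed.

Lemma ddy_sqF j z : D z -> ddy j (sqf F) z = 2 * (K z * m z (evec R j)).
Proof.
by move=> Dz; rewrite /ddy (is_diff_dir _ (is_diff_sqF Dz))/= mxE; ring.
Qed.

Lemma ddx_sqF j z : D z ->
  ddx j (sqf F) z = 2 * F z ^+ 2 * tau z * evec R j 0 ord0.
Proof.
move=> Dz; rewrite /ddx (is_diff_dir _ (is_diff_sqF Dz))/=.
rewrite (_ : m z 0 = 0) ?mulr0 ?addr0//.
by have := redmDZ c p q z (-1) 0 0; rewrite scaler0 addr0; lra.
Qed.

(** The metric tensor as a bilinear form on the fibre.  The expression is the
    one produced by the product rule; it is symmetric, although not visibly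
    so, because of the definition of N. *)
Definition metric_form z a b : R := K z *
  (p / N z * (s z * a 0 ord0 - u z / s z * B z.2 a) * m z b
   + (p * (B z.2 a / s z) + k * a 0 ord0) * b 0 ord0 + B a b).

Lemma is_diff_ddy_sqF j z : D z -> is_diff z (ddy j (sqf F))
  (fun v => 4 * K z * tau z * m z (evec R j) * v.1 0 ord0
            + 2 * metric_form z v.2 (evec R j)).
Proof.
move=> Dz.
have H := is_diff_mul (is_diff_const 2 z)
  (is_diff_mul (is_diff_metric_factor Dz)
     (is_diff_redm p q c_sym (evec R j) (Dphi Dz))).
have near_sqF : \near z, 2 * (K z * m z (evec R j)) = ddy j (sqf F) z.
  by apply: open_near Do Dz _ => y Dy; rewrite ddy_sqF.
apply: is_diff_eq (near_eq_is_diff near_sqF H) _.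
by apply/funext => v; rewrite /metric_form; ring.
Qed.

Lemma metric_tensorE z i j : D z ->
  metric_tensor F z i j = metric_form z (evec R i) (evec R j).
Proof.
move=> Dz; rewrite mxE {1}/ddy (is_diff_dir _ (is_diff_ddy_sqF j Dz))/= mxE.
by field.
Qed.

Lemma metric_formDZ z a t b b' :
  metric_form z a (t *: b + b') = t * metric_form z a b + metric_form z a b'.
Proof. by rewrite /metric_form redmDZ bilDZr !mxE; ring. Qed.

Lemma metric_tensor_mul z (v : V) i : D z ->
  (metric_tensor F z *m v^T) i 0 = metric_form z (evec R i) v.
Proof.
move=> Dz; rewrite mxE.
rewrite -(sum_evec v (fun t a b => metric_formDZ z (evec R i) t a b)).
by apply: eq_bigr => j _; rewrite metric_tensorE// !mxE.
Qed.

(** Euler's relation for the homogeneous function F^2. *)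
Lemma metric_form_self z b : D z -> metric_form z z.2 b = K z * m z b.
Proof.
move=> Dz; have s0 := rad_neq0 (Dphi Dz); have N0 := DN Dz.
rewrite /metric_form (bil_rad (Dphi Dz)) /redm; field; rewrite N0 s0//.
Qed.

(** If v is in the kernel, pairing with y gives m(v) = 0, and the remaining
    terms of the form then separate: the index 1 yields (1 + q) v^1 = 0 and the
    others c v = 0. *)
Lemma metric_nondeg z : D z -> metric_tensor F z \in unitmx.
Proof.
move=> Dz; have K0 := metric_factor_neq0 Dz; have s0 := rad_neq0 (Dphi Dz).
rewrite -unitmx_tr -row_free_unit -kermx_eq0; apply/rowV0P => v /sub_kermxP vg.
have gv i : metric_form z (evec R i) v = 0.
  by rewrite -metric_tensor_mul// -[_ *m _]trmxK trmx_mul trmxK vg !mxE.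
have gv' a : metric_form z a v = 0.
  have gl t b b' : metric_form z (t *: b + b') v =
      t * metric_form z b v + metric_form z b' v.
    by rewrite /metric_form bilDZr bilDZl !mxE; ring.
  have <- := sum_evec (L := metric_form z ^~ v) a gl.
  by rewrite big1// => i _; rewrite gv mul0r.
have mv : m z v = 0.
  have /eqP := gv' z.2; rewrite metric_form_self// mulf_eq0 (negbTE K0)/=.
  by move/eqP.
have bv i : p * (B z.2 (evec R i) / s z) * v 0 ord0
    + k * evec R i 0 ord0 * v 0 ord0 + B (evec R i) v = 0.
  have /eqP := gv i; rewrite /metric_form mv mulr0 add0r mulf_eq0 (negbTE K0)/=.
  by move=> /eqP <-; ring.
have v0 : v 0 ord0 = 0.
  have := bv ord0; rewrite bil_evec0r bil_evec0l mxE eqxx/= mul0r mulr0 mul0r.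
  by rewrite add0r addr0 mulr1 => /eqP; rewrite mulf_eq0 (negbTE q1) => /eqP.
apply: (bil_nondeg c_nonsing v0) => i.
by have := bv i; rewrite v0 !mulr0 !add0r.
Qed.

(** The stated spray, put as a combination of y and the first basis vector:
    the metric is easy to evaluate on these two. *)
Definition sprayvec z : V := tau z *:
  ((u z + p * s z / (2 * k)) *: z.2 - (N z / (2 * k)) *: evec R ord0).

(** The x-dependence of F^2 is the factor f^2 alone, so its mixed derivatives
    are multiples of the vertical ones. *)
Lemma spray_rhsE i z : D z ->
  \sum_r z.2 0 r * ddx r (ddy i (sqf F)) z - ddx i (sqf F) z =
  4 * tau z * K z * (u z * m z (evec R i) - N z / 2 * evec R i 0 ord0).
Proof.
move=> Dz; have N0 := DN Dz.
rewrite ddx_sqF// (eq_bigr (fun r => 4 * K z * tau z * m z (evec R i) *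
    (evec R r 0 ord0 * z.2 0 r))); last first.
  move=> r _; rewrite {1}/ddx (is_diff_dir _ (is_diff_ddy_sqF i Dz))/=.
  rewrite (_ : metric_form z 0 _ = 0); first by ring.
  by rewrite /metric_form !mxE bil0l bil0r; ring.
rewrite -mulr_sumr sum_evec0 /metric_factor.
by field.
Qed.

(** Multiplying the candidate by the metric avoids inverting the latter. *)
Lemma spray_metric i z : D z ->
  (metric_tensor F z *m (sprayvec z)^T) i 0 =
  tau z * K z * (u z * m z (evec R i) - N z / 2 * evec R i 0 ord0).
Proof.
move=> Dz; have N0 := DN Dz; have s0 := rad_neq0 (Dphi Dz).
have gsub t x w a b b' : metric_form z a (t *: (x *: b - w *: b')) =
    t * (x * metric_form z a b - w * metric_form z a b').
  rewrite -[t *: _]addr0 metric_formDZ -[w *: b']addr0 opprD -scaleNr.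
  rewrite metric_formDZ oppr0.
  rewrite metric_formDZ (_ : metric_form z a 0 = 0); first by ring.
  by have := metric_formDZ z a (-1) 0 0; rewrite scaler0 addr0; lra.
rewrite metric_tensor_mul// /sprayvec gsub.
rewrite /metric_form (redm_self p q (Dphi Dz)) (bilC c_sym (evec R i) z.2).
rewrite bil_evec0r /redm bil_evec0r.
rewrite evec00; move: N0; rewrite /redN (rad_sq (Dphi Dz)) => N0.
by field; rewrite N0 s0 q1.
Qed.

Lemma spray_coefE i z : D z -> spray_coef F i z = sprayvec z 0 i.
Proof.
move=> Dz; have gu := metric_nondeg Dz.
have <- : (invmx (metric_tensor F z) *m
    (metric_tensor F z *m (sprayvec z)^T)) i 0 = sprayvec z 0 i.
  by rewrite mulKmx// mxE.
rewrite mxE /spray_coef mulr_sumr; apply: eq_bigr => j _.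
by rewrite spray_metric// spray_rhsE//; field.
Qed.

Lemma derive_y_tau z b : 'D_((0 : V), b) tau z = 0.
Proof.
apply/lim_near_cst => //=; near=> h.
by rewrite /tau /= scaler0 add0r subrr scaler0.
Unshelve. all: by end_near. Qed.

(** The factor f'/f of the spray is constant along the fibres. *)
Lemma ddy_tauM j (h g : V * V -> R) (dg : V * V -> V * V -> R) :
  (forall z, D z -> h z = tau z * g z) ->
  (forall z, D z -> is_diff z g (dg z)) ->
  forall z, D z -> ddy j h z = tau z * dg z (0, evec R j).
Proof.
move=> hE gd z Dz.
rewrite /ddy (near_eq_derive _ (open_near Do Dz hE)).
rewrite (is_diff_dir _ (is_diff_mul (Ck_diff (Ck_tau 1) Dz) (gd _ Dz)))/=.
by rewrite derive_y_tau; ring.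
Qed.

(** The coordinate h of a, except that it is 0 for the index 1: it absorbs the
    term in the first basis vector of [sprayvec], since the non-quadratic part
    p u s of N cancels the term s u of the first component. *)
Definition tcoord (h : 'I_n.+1) a : R := a 0 h - a 0 ord0 * evec R ord0 0 h.

(** First, second and third derivatives of s in the directions a, b, d. *)
Definition drad z a := B z.2 a / s z.
Definition d2rad z a b := B a b / s z - B z.2 a * B z.2 b / s z ^+ 3.
Definition d3rad z a b d := 3 * B z.2 a * B z.2 b * B z.2 d / s z ^+ 5
  - (B a b * B z.2 d + B a d * B z.2 b + B b d * B z.2 a) / s z ^+ 3.

Lemma is_diff_tcoord h z :
  is_diff z (fun z => tcoord h z.2) (fun v => tcoord h v.2).
Proof.
have H := is_diff_add (is_diff_y h z) (is_diff_mul (is_diff_y ord0 z)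
  (is_diff_const (- evec R ord0 0 h) z)).
by apply: is_diff_ext H _ _ => y; rewrite /tcoord; ring.
Qed.

Lemma is_diff_drad a z : D z -> is_diff z (drad ^~ a) (fun v => d2rad z v.2 a).
Proof.
move=> Dz; have s0 := rad_neq0 (Dphi Dz).
apply: is_diff_eq (is_diff_mul (is_diff_bil c a z)
  (is_diff_inv s0 (is_diff_rad c_sym (Dphi Dz)))) _.
by apply/funext => v; rewrite /d2rad; field.
Qed.

Lemma is_diff_d2rad a b z : D z ->
  is_diff z (fun z => d2rad z a b) (fun v => d3rad z v.2 a b).
Proof.
move=> Dz; have s0 := rad_neq0 (Dphi Dz).
have ds := is_diff_inv s0 (is_diff_rad c_sym (Dphi Dz)).
have dB := is_diff_mul (is_diff_bil c a z) (is_diff_bil c b z).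
have H := is_diff_add (is_diff_mul (is_diff_const (B a b) z) ds)
  (is_diff_mul (is_diff_const (-1) z)
     (is_diff_mul dB (is_diff_mul ds (is_diff_mul ds ds)))).
apply: is_diff_ext H _ _ => y; last by rewrite /d3rad; field.
by rewrite /d2rad !exprS expr0 mulr1 !invfM; ring.
Qed.

(** The part of the spray that is quadratic in y and so is invisible to the
    Berwald tensor. *)
Lemma is_diff_quad h z :
  is_diff z (fun z => u z * z.2 0 h - (phi c z.2 + k * u z ^+ 2) / (2 * k)
                * evec R ord0 0 h)
  (fun v => u z * v.2 0 h + z.2 0 h * u v - (B z.2 v.2 + k * u z * u v) / k
                * evec R ord0 0 h).
Proof.
have H := is_diff_add (is_diff_mul (is_diff_y ord0 z) (is_diff_y h z))
 (is_diff_mul (is_diff_const (- (evec R ord0 0 h / (2 * k))) z)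
   (is_diff_add (is_diff_phi c_sym z)
    (is_diff_mul (is_diff_const k z)
      (is_diff_mul (is_diff_y ord0 z) (is_diff_y ord0 z))))).
by apply: is_diff_ext H _ _ => y; field.
Qed.

Local Notation kappa := (p / (2 * k)).

(** Only s times a linear form survives three differentiations: the result is
    Leibniz' rule for that product. *)
Lemma berwaldE h i j l z : D z ->
  berwald_tensor (spray_coef F) h i j l z = tau z * (kappa *
    (d3rad z (evec R i) (evec R j) (evec R l) * tcoord h z.2
     + d2rad z (evec R j) (evec R l) * tcoord h (evec R i)
     + d2rad z (evec R i) (evec R l) * tcoord h (evec R j)
     + d2rad z (evec R i) (evec R j) * tcoord h (evec R l))).
Proof.
move=> Dz.
pose a := evec R i; pose b := evec R j; pose d := evec R l.
pose e := evec R ord0 0 h.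
(* G0, G1, G2: the spray coefficient and its successive vertical derivatives,
   without the factor f'/f *)
pose G0 z := u z * z.2 0 h - (phi c z.2 + k * u z ^+ 2) / (2 * k) * e
  + kappa * (s z * tcoord h z.2).
pose G1 z := u z * d 0 h + z.2 0 h * d 0 ord0
  - (B z.2 d + k * u z * d 0 ord0) / k * e
  + kappa * (drad z d * tcoord h z.2 + s z * tcoord h d).
pose G2 z := b 0 ord0 * d 0 h + b 0 h * d 0 ord0
  - (B b d + k * b 0 ord0 * d 0 ord0) / k * e
  + kappa * (d2rad z b d * tcoord h z.2 + drad z d * tcoord h b
             + drad z b * tcoord h d).
have G0E y : D y -> spray_coef F h y = tau y * G0 y.
  move=> Dy; rewrite spray_coefE// /sprayvec !mxE /G0 /e /tcoord /redN.
  by rewrite !mxE; field.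
have dG0 y : D y -> is_diff y G0 (fun v =>
    u y * v.2 0 h + y.2 0 h * u v - (B y.2 v.2 + k * u y * u v) / k * e
    + kappa * (B y.2 v.2 / s y * tcoord h y.2 + s y * tcoord h v.2)).
  move=> Dy; have H := is_diff_add (is_diff_quad h y)
    (is_diff_mul (is_diff_const kappa y)
      (is_diff_mul (is_diff_rad c_sym (Dphi Dy)) (is_diff_tcoord h y))).
  by apply: is_diff_ext H _ _ => v; rewrite /G0 -/e; ring.
have G1E y : D y -> ddy l (spray_coef F h) y = tau y * G1 y.
  exact: (ddy_tauM l G0E dG0).
have dG1 y : D y -> is_diff y G1 (fun v =>
    u v * d 0 h + v.2 0 h * d 0 ord0 - (B v.2 d + k * u v * d 0 ord0) / k * e
    + kappa * (d2rad y v.2 d * tcoord h y.2 + drad y d * tcoord h v.2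
               + drad y v.2 * tcoord h d)).
  move=> Dy; have H := is_diff_add (is_diff_add (is_diff_add
      (is_diff_mul (is_diff_y ord0 y) (is_diff_const (d 0 h) y))
      (is_diff_mul (is_diff_y h y) (is_diff_const (d 0 ord0) y)))
    (is_diff_mul (is_diff_const (- (e / k)) y) (is_diff_add (is_diff_bil c d y)
      (is_diff_mul (is_diff_const (k * d 0 ord0) y) (is_diff_y ord0 y)))))
    (is_diff_mul (is_diff_const kappa y) (is_diff_add
      (is_diff_mul (is_diff_drad d Dy) (is_diff_tcoord h y))
      (is_diff_mul (is_diff_rad c_sym (Dphi Dy))
         (is_diff_const (tcoord h d) y)))).
  have s0 := rad_neq0 (Dphi Dy).
  apply: is_diff_ext H _ _ => v; first by rewrite /G1; field.
  by rewrite /drad; field; rewrite q1 s0.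
have G2E y : D y -> ddy j (ddy l (spray_coef F h)) y = tau y * G2 y.
  exact: (ddy_tauM j G1E dG1).
have dG2 y : D y -> is_diff y G2 (fun v =>
    kappa * (d3rad y v.2 b d * tcoord h y.2 + d2rad y b d * tcoord h v.2
     + d2rad y v.2 d * tcoord h b + d2rad y v.2 b * tcoord h d)).
  move=> Dy; have H := is_diff_add
    (is_diff_const (b 0 ord0 * d 0 h + b 0 h * d 0 ord0
      - (B b d + k * b 0 ord0 * d 0 ord0) / k * e) y)
    (is_diff_mul (is_diff_const kappa y) (is_diff_add (is_diff_add
      (is_diff_mul (is_diff_drad d Dy) (is_diff_const (tcoord h b) y))
      (is_diff_mul (is_diff_d2rad b d Dy) (is_diff_tcoord h y)))
      (is_diff_mul (is_diff_drad b Dy) (is_diff_const (tcoord h d) y)))).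
  by apply: is_diff_ext H _ _ => v; rewrite /G2; ring.
by rewrite /berwald_tensor (ddy_tauM i G2E dG2 Dz).
Qed.

(** Contraction with [tcoord] of a linear form that ignores the first
    coordinate. *)
Lemma sum_tcoord (L : V -> R) a :
  (forall t b b', L (t *: b + b') = t * L b + L b') -> L (evec R ord0) = 0 ->
  \sum_h L (evec R h) * tcoord h a = L a.
Proof.
move=> Ll L0; rewrite -(sum_evec a Ll).
rewrite [LHS](eq_bigr (fun h => L (evec R h) * a 0 h)) => [//|h _].
rewrite /tcoord mxE eqxx/=; have [->|_] := eqVneq h ord0.
  by rewrite L0 !mul0r.
by rewrite mulr0 subr0.
Qed.

(** The contraction replaces [tcoord h a] by <y, a>, and the four terms become
    s times the third derivative of the quadratic form s^2 / 2. *)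
Lemma dlog_landsberg : landsberg D F.
Proof.
move=> z i j l Dz; have s0 := rad_neq0 (Dphi Dz); have N0 := DN Dz.
rewrite /landsberg_tensor.
have contract a : \sum_h B z.2 (evec R h) * tcoord h a = B z.2 a.
  apply: sum_tcoord; last exact: bil_evec0r.
  by move=> t b b'; exact: bilDZr.
pose A3 := d3rad z (evec R i) (evec R j) (evec R l).
pose Ai := d2rad z (evec R j) (evec R l).
pose Aj := d2rad z (evec R i) (evec R l).
pose Al := d2rad z (evec R i) (evec R j).
pose C := F z / N z * tau z * kappa.
rewrite (eq_bigr (fun h =>
    C * A3 * (B z.2 (evec R h) * tcoord h z.2)
    + C * Ai * (B z.2 (evec R h) * tcoord h (evec R i))
    + C * Aj * (B z.2 (evec R h) * tcoord h (evec R j))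
    + C * Al * (B z.2 (evec R h) * tcoord h (evec R l)))); last first.
  move=> h _; rewrite berwaldE// /ddy (is_diff_dir _ (F_dlog Dz))/= mxE /redm.
  (* the part of m along the index 1 is lost, [tcoord ord0] being 0 *)
  have tcoord0 a : evec R h 0 ord0 * tcoord h a = 0.
    rewrite /tcoord !mxE eqxx/= eq_sym; have [->|_] := eqVneq h ord0.
      by rewrite mulr1 subrr mulr0.
    by rewrite mul0r.
  rewrite -/A3 -/Ai -/Aj -/Al /C.
  transitivity (F z / N z * tau z * kappa * (
    (p * s z + k * u z) * (A3 * (evec R h 0 ord0 * tcoord h z.2)
     + Ai * (evec R h 0 ord0 * tcoord h (evec R i))
     + Aj * (evec R h 0 ord0 * tcoord h (evec R j))
     + Al * (evec R h 0 ord0 * tcoord h (evec R l)))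
    + B z.2 (evec R h) * (A3 * tcoord h z.2 + Ai * tcoord h (evec R i)
     + Aj * tcoord h (evec R j) + Al * tcoord h (evec R l)))); first by ring.
  by rewrite !tcoord0; ring.
rewrite !big_split/= -!mulr_sumr !contract (bil_rad (Dphi Dz)).
rewrite /A3 /Ai /Aj /Al /d3rad /d2rad.
by field.
Qed.

(** Since s has degree one in y, its second derivatives have degree -1; the
    trace of the Berwald tensor thereby reduces to (n + 1) s_jk, up to the factor
    p f' / (2 k f).  When all the s_jk vanish, c is the product of a column by
    a row. *)
Lemma dlog_not_berwald z : (1 < n)%N -> p != 0 -> D z ->
  derive1 f (x1 z.1) != 0 ->
  ~ berwald D F.
Proof.
move=> n1 p0 Dz f'0 /(_ z) Fb; have s0 := rad_neq0 (Dphi Dz).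
have tau0 : tau z != 0.
  by rewrite mulf_neq0// invr_neq0// gt_eqF// f_pos//; exact: DU.
have kappa0 : kappa != 0 by rewrite mulf_neq0// invr_neq0// mulf_neq0.
have d2rad_eq0 j l : d2rad z (evec R j) (evec R l) = 0.
  have trace : \sum_h (d3rad z (evec R h) (evec R j) (evec R l) * tcoord h z.2
     + d2rad z (evec R j) (evec R l) * tcoord h (evec R h)
     + d2rad z (evec R h) (evec R l) * tcoord h (evec R j)
     + d2rad z (evec R h) (evec R j) * tcoord h (evec R l)) = 0.
    apply: big1 => h _; apply/eqP; have := Fb h h j l Dz.
    rewrite berwaldE// => /eqP; rewrite mulf_eq0 (negbTE tau0)/=.
    by rewrite mulf_eq0 (negbTE kappa0).
  have d2radZ a t b b' :
      d2rad z (t *: b + b') a = t * d2rad z b a + d2rad z b' a.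
    by rewrite /d2rad bilDZl bilDZr; field.
  have d2rad0 a : d2rad z (evec R ord0) a = 0.
    by rewrite /d2rad bil_evec0l bil_evec0r; field.
  have tcoord_trace : \sum_h tcoord h (evec R h) = n%:R.
    rewrite big_ord_recl /tcoord evec00 mul1r subrr add0r.
    rewrite (eq_bigr (fun=> 1)); first by rewrite sumr_const card_ord.
    by move=> h _; rewrite !mxE !eqxx /= mul0r subr0.
  have sum3 : \sum_h d3rad z (evec R h) (evec R j) (evec R l) * tcoord h z.2 =
      d3rad z z.2 (evec R j) (evec R l).
    apply: (sum_tcoord (L := fun a => d3rad z a (evec R j) (evec R l))).
      by move=> t b b'; rewrite /d3rad !bilDZl !bilDZr; field.
    by rewrite /d3rad !bil_evec0l bil_evec0r; field.
  have sum2 a b : \sum_h d2rad z (evec R h) a * tcoord h b = d2rad z b a.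
    by apply: (sum_tcoord (L := fun b => d2rad z b a)).
  move: trace; rewrite !big_split/= -mulr_sumr tcoord_trace sum3 !sum2.
  have -> : d3rad z z.2 (evec R j) (evec R l) = - d2rad z (evec R j) (evec R l).
    by rewrite /d3rad /d2rad (bil_rad (Dphi Dz)); field.
  rewrite (_ : d2rad z _ (evec R j) = d2rad z (evec R j) (evec R l)).
    have n0 : n.+1%:R != 0 :> R by rewrite pnatr_eq0.
    move=> E; apply/eqP; rewrite -[_ == 0]orFb -(negbTE n0) -mulf_eq0.
    by rewrite -E -natr1; apply/eqP; ring.
  by rewrite /d2rad (bilC c_sym (evec R l)); ring.
pose eta : 'rV[R]_n := \row_l B z.2 (evec R (lift ord0 l)).
have cE : c = eta^T *m ((s z) ^- 2 *: eta).
  apply/matrixP => j l; rewrite !mxE big_ord1 !mxE -bil_evec.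
  have := d2rad_eq0 (lift ord0 j) (lift ord0 l); rewrite /d2rad => /eqP.
  rewrite subr_eq0 => /eqP E.
  by rewrite -[LHS](mulfVK s0) E; field.
have := mxrank_unit c_nonsing; rewrite cE => rk.
have := leq_trans (mxrankM_maxr eta^T ((s z) ^- 2 *: eta)) (rank_leq_row _).
by rewrite rk leqNgt n1.
Qed.

End ScaledMetric.

(** * The two conic domains *)

Section Domains.
Variables (R : realType) (n : nat) (U : set 'rV[R]_n.+1) (f : R -> R).
Variables (c : 'M[R]_n) (p q a : R).
Local Notation V := 'rV[R]_n.+1.
Hypothesis hU : open U.
Hypothesis f_pos : forall x, U x -> 0 < f (x1 x).
Hypothesis c_sym : c^T = c.
Local Notation u z := (z.2 0 ord0).
Local Notation s := (rad c).
Local Notation N := (redN c p q).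
Implicit Types (z : V * V).

(** Where (y^1)^2 + phi is negative, [alpha] is 0 by convention, and both sides
    are false. *)
Lemma alpha_beta_gt0 z : U z.1 ->
  (0 < alpha f c z ^+ 2 - beta f z ^+ 2) = (0 < phi c z.2).
Proof.
move=> /f_pos f0; rewrite /alpha /beta !exprMn -mulrBr.
rewrite pmulr_rgt0 ?exprn_gt0//.
have [h|h] := leP 0 (u z ^+ 2 + phi c z.2).
  by rewrite sqr_sqrtr// addrC addKr.
have phi0 : phi c z.2 < 0 by apply: le_lt_trans h; rewrite lerDr sqr_ge0.
rewrite (lt_gtF phi0) ler0_sqrtr ?(ltW h)// expr0n/= sub0r oppr_gt0.
by rewrite ltNge sqr_ge0.
Qed.

Lemma alphaE z : 0 < phi c z.2 ->
  alpha f c z ^+ 2 = f (x1 z.1) ^+ 2 * (u z ^+ 2 + s z ^+ 2).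
Proof.
move=> h; rewrite /alpha exprMn sqr_sqrtr ?(rad_sq h)//.
by rewrite addr_ge0 ?sqr_ge0.
Qed.

Lemma wE z : U z.1 -> 0 < phi c z.2 -> w f c z = f (x1 z.1) * s z.
Proof.
move=> /f_pos f0 h; rewrite /w alphaE// /beta.
rewrite (_ : _ - _ = (f (x1 z.1) * s z) ^+ 2); last by ring.
by rewrite sqrtr_sqr ger0_norm// mulr_ge0 ?ltW ?rad_gt0.
Qed.

Lemma NNE z : U z.1 -> 0 < phi c z.2 ->
  NN f c p q z = f (x1 z.1) ^+ 2 * N z.
Proof.
by move=> Uz h; rewrite /NN alphaE// wE// /beta /redN (rad_sq h); ring.
Qed.

Lemma dom_mainE : dom_main f c U p q =
  [set z | [/\ U z.1, 0 < phi c z.2, u z != 0 & N z != 0]].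
Proof.
apply/seteqP; split=> z /= [Uz].
- rewrite alpha_beta_gt0// => h; rewrite NNE// /beta => b0 N0; split=> //.
    by apply: contra b0 => /eqP->; rewrite mulr0.
  by apply: contra N0 => /eqP->; rewrite mulr0.
- move=> h u0 N0; have f0 : f (x1 z.1) != 0 by rewrite gt_eqF// f_pos.
  by split; rewrite ?alpha_beta_gt0 ?NNE// ?mulf_neq0 ?expf_neq0.
Qed.

Lemma dom_degenE : dom_degen f c U a =
  [set z | [/\ U z.1, 0 < phi c z.2 & a * u z + s z != 0]].
Proof.
have E z : U z.1 -> 0 < phi c z.2 ->
    a * beta f z + w f c z = f (x1 z.1) * (a * u z + s z).
  by move=> Uz h; rewrite wE// /beta; ring.
apply/seteqP; split=> z /= [Uz].
- rewrite alpha_beta_gt0// => h; rewrite E// => b0; split=> //.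
  by apply: contra b0 => /eqP->; rewrite mulr0.
- move=> h b0; have f0 : f (x1 z.1) != 0 by rewrite gt_eqF// f_pos.
  by split; rewrite ?alpha_beta_gt0 ?E// mulf_neq0.
Qed.

Lemma continuous_u : continuous (fun z => u z).
Proof.
by move=> z; apply: differentiable_continuous; case: (is_diff_y ord0 z).
Qed.

Lemma continuous_phi : continuous (fun z : V * V => phi c z.2).
Proof.
by move=> z; apply: differentiable_continuous; case: (is_diff_phi c_sym z).
Qed.

(** Continuity of s, including at the zeros of phi, makes the domains open as
    intersections of preimages under globally continuous functions. *)
Lemma continuous_rad : continuous s.
Proof.
move=> z; apply: (@continuous_comp _ _ _ (fun z : V * V => phi c z.2)).
  exact: continuous_phi.
exact: sqrt_continuous.
Qed.

Lemma continuous_redN : continuous N.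
Proof.
move=> z.
apply: (@cvgD _ R^o _ _ _ (fun z => phi c z.2 + p * u z * s z)
  (fun z => (1 + q) * u z ^+ 2)).
  apply: (@cvgD _ R^o _ _ _ (fun z => phi c z.2) (fun z => p * u z * s z)).
    exact: continuous_phi.
  apply: cvgM; last exact: continuous_rad.
  by apply: cvgM; [exact: cvg_cst|exact: continuous_u].
apply: cvgM; first exact: cvg_cst.
by rewrite expr2; apply: cvgM; exact: continuous_u.
Qed.

Lemma open_U_phi : open [set z : V * V | U z.1 /\ 0 < phi c z.2].
Proof.
apply: openI.
  by apply: (@open_comp _ _ (@fst V V) U) => // z _; exact: cvg_fst.
apply: (@open_comp _ _ (fun z : V * V => phi c z.2) [set x | 0 < x]).
  by move=> z _; exact: continuous_phi.
exact: open_gt.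
Qed.

Lemma open_preim_neq0 (g : V * V -> R) : continuous g ->
  open [set z | g z != 0].
Proof.
move=> gc; apply: (@open_comp _ _ g [set x | x != 0]) => [z _|].
  exact: gc.
exact: open_neq.
Qed.

Lemma open_dom_main : open (dom_main f c U p q).
Proof.
rewrite dom_mainE (_ : [set _ | _] =
  [set z : V * V | U z.1 /\ 0 < phi c z.2] `&`
  ([set z : V * V | u z != 0] `&` [set z : V * V | N z != 0])).
  apply: openI; first exact: open_U_phi.
  apply: openI; apply: open_preim_neq0; first exact: continuous_u.
  exact: continuous_redN.
by apply/seteqP; split=> z /=; [case|case=> -[? ?] []].
Qed.

Lemma open_dom_degen : open (dom_degen f c U a).
Proof.
rewrite dom_degenE (_ : [set _ | _] =
  [set z : V * V | U z.1 /\ 0 < phi c z.2] `&`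
  [set z : V * V | a * u z + s z != 0]).
  apply: openI; first exact: open_U_phi.
  apply: open_preim_neq0 => z.
  apply: (@cvgD _ R^o _ _ _ (fun z => a * u z) s); last exact: continuous_rad.
  by apply: cvgM; [exact: cvg_cst|exact: continuous_u].
by apply/seteqP; split=> z /=; [case|case=> -[? ?]].
Qed.

Lemma phiZ t (y : V) : phi c (t *: y) = t ^+ 2 * phi c y.
Proof.
rewrite !phi_bil -[t *: y]addr0 bilDZl bilDZr bil0l bil0r; ring.
Qed.

Lemma radZ t (x y : V) : 0 < t -> s (x, t *: y) = t * s (x, y).
Proof.
move=> t0; rewrite /rad /= phiZ sqrtrM ?sqr_ge0// sqrtr_sqr.
by rewrite gtr0_norm.
Qed.

Lemma redNZ t (x y : V) : 0 < t -> N (x, t *: y) = t ^+ 2 * N (x, y).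
Proof. by move=> t0; rewrite /redN /= radZ// phiZ !mxE; ring. Qed.

(** Changing y^1 does not affect phi, and N, as a quadratic polynomial in y^1
    with middle coefficient p s <> 0, cannot vanish at both 1 and -1. *)
Lemma regular_direction (x : V) : p != 0 -> 1 + q != 0 ->
  (exists y : V, 0 < phi c y) ->
  exists y : V, [/\ 0 < phi c y, y 0 ord0 != 0 & N (x, y) != 0].
Proof.
move=> p0 q1 [y0 y0p].
pose y t := (t - y0 0 ord0) *: evec R ord0 + y0.
have phiy t : phi c (y t) = phi c y0.
  by rewrite !phi_bil /y !bilDZl !bilDZr !bil_evec0l !bil_evec0r; ring.
have uy t : y t 0 ord0 = t by rewrite !mxE eqxx/=; ring.
have [N1|N1] := eqVneq (N (x, y 1)) 0; last first.
  by exists (y 1); rewrite phiy uy oner_neq0.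
exists (y (-1)); rewrite phiy uy oppr_eq0 oner_neq0; split=> //.
apply/eqP => N2; move: N1 N2; rewrite /redN /rad /= !phiy !uy => N1 N2.
have s0 : p * Num.sqrt (phi c y0) != 0.
  by rewrite mulf_neq0// sqrtr_eq0 -ltNge.
by move/eqP: s0; apply; move: N1 N2; lra.
Qed.

Lemma S_coefE z i : U z.1 -> 0 < phi c z.2 -> 1 + q != 0 ->
  S_coef f c p q i z = sprayvec f c p q z 0 i.
Proof.
move=> Uz h q1; have f0 : f (x1 z.1) != 0 by rewrite gt_eqF// f_pos.
rewrite /S_coef /PP wE// alphaE// /beta /sprayvec /tau !mxE /redN (rad_sq h).
by have [->|i0] := eqVneq i ord0; rewrite ?eqxx/=; field; rewrite q1 f0.
Qed.

End Domains.

(** * From the differential equation to metrizability *)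

Section Metrizability.
Variables (R : realType) (n : nat) (U : set 'rV[R]_n.+1) (f : R -> R).
Variables (c : 'M[R]_n) (p q : R).
Local Notation V := 'rV[R]_n.+1.
Hypothesis f_smooth : smooth_on (@x1 R n @` U) f.
Hypothesis f_pos : forall x, U x -> 0 < f (x1 x).
Hypotheses (c_sym : c^T = c) (c_nonsing : c \in unitmx) (q1 : 1 + q != 0).
Local Notation k := (1 + q).
Local Notation u z := (z.2 0 ord0).
Local Notation s := (rad c).
Local Notation N := (redN c p q).
Local Notation m := (redm c p q).
Implicit Types (z : V * V).

Lemma dlog_metrizable (D : set (V * V)) (F : V * V -> R) :
  open D -> D !=set0 ->
  (forall z, D z -> [/\ U z.1, 0 < phi c z.2 & N z != 0]) ->
  (forall x y (t : R), 0 < t -> D (x, y) -> D (x, t *: y)) ->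
  (forall x y (t : R), 0 < t -> D (x, y) -> F (x, t *: y) = t * F (x, y)) ->
  (forall z, D z -> F z != 0) ->
  (forall z, D z ->
     is_diff z F (fun v => F z * (tau f z * v.1 0 ord0 + m z v.2 / N z))) ->
  metrizable_by D (S_coef f c p q) F.
Proof.
move=> Do D0 DP Dcone Fhom F0 dF.
have DU z : D z -> U z.1 by case/DP.
have Dphi z : D z -> 0 < phi c z.2 by case/DP.
have DN z : D z -> N z != 0 by case/DP.
split=> [|z i Dz]; last first.
  rewrite (S_coefE p f_pos i (DU _ Dz) (Dphi _ Dz) q1).
  by rewrite (spray_coefE c_sym c_nonsing q1 Do Dphi DN F0 dF).
split=> //.
- move=> z /Dphi; apply: contraTneq => ->.
  by rewrite phi_bil bil0l ltxx.
- exact: (dlog_smooth f_smooth f_pos Do DU Dphi DN dF).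
- exact: (metric_nondeg c_sym c_nonsing q1 Do Dphi DN F0 dF).
Qed.

Lemma is_diff_f z : U z.1 ->
  is_diff z (fun z => f (x1 z.1)) (fun v => derive1 f (x1 z.1) * v.1 0 ord0).
Proof.
move=> Uz; apply: is_diff_chain (is_diff_x ord0 z) _.
split; last by rewrite derive1E.
by apply/derivable1_diffP; apply: (f_smooth 1).1; exists z.1.
Qed.

End Metrizability.

(** * The exponent of the generic metric *)

Section MainProfile.
Variables (R : realType) (p q : R).

Lemma is_derive_ln_abs (x : R) : x != 0 ->
  is_derive x 1 (fun y : R => ln `|y|) x^-1.
Proof.
move=> x0; have [xp|xn|xE] := ltgtP 0 x; last by rewrite xE eqxx in x0.
- apply: near_eq_is_derive (is_derive1_ln xp).
  near=> y; rewrite gtr0_norm//; near: y.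
  by apply: open_near (xp : [set y | 0 < y] x) _ => //; exact: open_gt.
- have nx : 0 < - x by rewrite oppr_gt0.
  have dopp : is_diff x (fun y => - y) (fun v => - v) by exact: is_diffN.
  have [H1 H2] := is_diff_chain dopp (is_derive1_ln nx).
  have dN : is_derive x 1 (fun y => ln (- y)) x^-1.
    split; first by apply/derivable1_diffP.
    by rewrite deriveE// H2; field.
  apply: near_eq_is_derive dN.
  near=> y; rewrite ltr0_norm//; near: y.
  by apply: open_near (xn : [set y | y < 0] x) _ => //; exact: open_lt.
Unshelve. all: by end_near. Qed.

(** The exponent of [F_main] as a function of t = w / beta. *)
Definition profile (t : R) : R :=
  if 0 < Delta p q then
    let d := Num.sqrt (Delta p q) in
    p / (2 * d) * ln `|(d + p + 2 * t) / (d - p - 2 * t)|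
  else
    let d := Num.sqrt (- Delta p q) in
    - (p / d) * atan ((p + 2 * t) / d).

(** The two closed forms are the real primitives of one rational function, whose
    denominator has discriminant Delta. *)
Lemma is_derive_profile t : Delta p q != 0 -> t ^+ 2 + p * t + (1 + q) != 0 ->
  is_derive t 1 profile (- p / (2 * (t ^+ 2 + p * t + (1 + q)))).
Proof.
move=> D0 t0; have id := is_diff_id t.
suff [H1 H2] : is_diff t profile
    (fun v => - p / (2 * (t ^+ 2 + p * t + (1 + q))) * v).
  by split; [exact/derivable1_diffP|rewrite deriveE// H2 mulr1].
have [Dp|Dn] := boolP (0 < Delta p q).
- pose d := Num.sqrt (Delta p q).
  have d0 : d != 0 by rewrite gt_eqF// sqrtr_gt0.
  have dd : d ^+ 2 = p ^+ 2 - 4 * q - 4 by rewrite sqr_sqrtr// ltW.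
  have prod : (d + p + 2 * t) * (d - p - 2 * t) =
      - 4 * (t ^+ 2 + p * t + (1 + q)).
    by transitivity (d ^+ 2 - (p + 2 * t) ^+ 2); [ring|rewrite dd; ring].
  have : (d + p + 2 * t) * (d - p - 2 * t) != 0.
    by rewrite prod mulf_neq0// oppr_eq0 pnatr_eq0.
  rewrite mulf_eq0 negb_or => /andP[n0 m0].
  have dnum := is_diff_add (is_diff_const (d + p) t)
    (is_diff_mul (is_diff_const 2 t) id).
  have dden := is_diff_add (is_diff_const (d - p) t)
    (is_diff_mul (is_diff_const (-2) t) id).
  have m0' : d - p + (-2) * t != 0 by rewrite mulNr.
  have dr := is_diff_mul dnum
    (is_diff_inv (f := fun y : R => d - p + (-2) * y) m0' dden).
  have r0 : (d + p + 2 * t) / (d - p + (-2) * t) != 0.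
    by rewrite mulf_neq0 ?invr_neq0.
  have H := is_diff_mul (is_diff_const (p / (2 * d)) t)
    (is_diff_chain dr (is_derive_ln_abs r0)).
  apply: is_diff_ext H _ _ => v; first by rewrite /profile Dp mulNr.
  have -> : t ^+ 2 + p * t + (1 + q) =
      - 4^-1 * ((d + p + 2 * t) * (d - p - 2 * t)) by rewrite prod; field.
  by rewrite mulNr; field; rewrite d0 n0 m0.
- have Dn' : 0 < - Delta p q by rewrite oppr_gt0 lt_neqAle D0 leNgt.
  pose d := Num.sqrt (- Delta p q).
  have d0 : d != 0 by rewrite gt_eqF// sqrtr_gt0.
  have dd : d ^+ 2 = - (p ^+ 2 - 4 * q - 4) by rewrite sqr_sqrtr// ltW.
  have dr := is_diff_mul (is_diff_add (is_diff_const p t)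
    (is_diff_mul (is_diff_const 2 t) id)) (is_diff_const d^-1 t).
  have H := is_diff_mul (is_diff_const (- (p / d)) t)
    (is_diff_chain dr (is_derive1_atan _)).
  apply: is_diff_ext H _ _ => v; first by rewrite /profile (negbTE Dn).
  have sum : d ^+ 2 + (p + 2 * t) ^+ 2 = 4 * (t ^+ 2 + p * t + (1 + q)).
    by rewrite dd; ring.
  have sum0 : d ^+ 2 + (p + 2 * t) ^+ 2 != 0.
    by rewrite sum mulf_neq0// pnatr_eq0.
  have -> : t ^+ 2 + p * t + (1 + q) = 4^-1 * (d ^+ 2 + (p + 2 * t) ^+ 2).
    by rewrite sum; field.
  by field; rewrite d0 sum0.
Qed.

End MainProfile.

(** * The generic and the degenerate metrics *)

Section FundamentalFunctions.
Variables (R : realType) (n : nat) (U : set 'rV[R]_n.+1) (f : R -> R).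
Variables (c : 'M[R]_n) (p q : R).
Local Notation V := 'rV[R]_n.+1.
Hypothesis hU : open U.
Hypothesis f_smooth : smooth_on (@x1 R n @` U) f.
Hypothesis f_pos : forall x, U x -> 0 < f (x1 x).
Hypotheses (c_sym : c^T = c).
Local Notation k := (1 + q).
Local Notation u z := (z.2 0 ord0).
Local Notation s := (rad c).
Local Notation N := (redN c p q).
Local Notation m := (redm c p q).
Implicit Types (z : V * V).

(** For Delta < 0 this makes N positive, so that the square root of N in
    [F_main] is that of its absolute value for both signs of Delta. *)
Lemma redN_Delta z : 0 < phi c z.2 ->
  4 * N z = (2 * s z + p * u z) ^+ 2 - Delta p q * u z ^+ 2.
Proof. by move=> h; rewrite /redN (rad_sq h) /Delta; ring. Qed.

Lemma F_mainE z : dom_main f c U p q z -> Delta p q != 0 ->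
  F_main f c p q z =
  f (x1 z.1) * (Num.sqrt `|N z| * expR (profile p q (s z / u z))).
Proof.
rewrite (dom_mainE c p q f_pos) => -[Uz h u0 N0] D0.
have f0 := f_pos Uz; have fn0 : f (x1 z.1) != 0 by rewrite gt_eqF.
have sqN : Num.sqrt `|NN f c p q z| = f (x1 z.1) * Num.sqrt `|N z|.
  rewrite (NNE p q f_pos)// normrM sqrtrM// ger0_norm ?sqr_ge0//.
  by rewrite sqrtr_sqr (gtr0_norm f0).
rewrite /F_main /profile (wE f_pos Uz h) /beta; case: ifPn => [Dp|Dn].
- rewrite /= sqN [RHS]mulrA; congr (_ * expR (_ * ln `|_|)).
  move: (Num.sqrt (Delta p q)) => d.
  rewrite (_ : d + p + _ = (u z * d + p * u z + 2 * s z) / u z); last by field.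
  rewrite (_ : d - p - _ = (u z * d - p * u z - 2 * s z) / u z); last by field.
  rewrite -mulf_div invrK mulVf// mulr1.
  rewrite (_ : f _ * u z * d + _ + _ =
    f (x1 z.1) * (u z * d + p * u z + 2 * s z)); last by ring.
  rewrite (_ : f _ * u z * d - _ - _ =
    f (x1 z.1) * (u z * d - p * u z - 2 * s z)); last by ring.
  by rewrite -mulf_div divff// mul1r.
- have Dlt : Delta p q < 0 by rewrite lt_neqAle D0 leNgt.
  have NNge0 : 0 <= NN f c p q z.
    rewrite (NNE p q f_pos)// mulr_ge0 ?sqr_ge0//.
    rewrite -(pmulr_rge0 _ (ltr0n R 4)) redN_Delta// subr_ge0.
    apply: le_trans (sqr_ge0 _); rewrite mulr_le0_ge0 ?sqr_ge0//; exact: ltW.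
  rewrite /= -{1}(ger0_norm NNge0) sqN [RHS]mulrA.
  congr (_ * expR (_ * atan _)).
  have d0 : Num.sqrt (- Delta p q) != 0.
    by rewrite sqrtr_eq0 -ltNge oppr_gt0.
  by field; rewrite fn0 d0 u0.
Qed.

Lemma F_main_neq0 z : dom_main f c U p q z -> Delta p q != 0 ->
  F_main f c p q z != 0.
Proof.
move=> Dz D0; rewrite F_mainE//.
move: Dz; rewrite (dom_mainE c p q f_pos) => -[Uz h u0 N0].
rewrite !mulf_neq0 ?gt_eqF ?expR_gt0 ?f_pos// sqrtr_gt0 normr_gt0//.
Qed.

Lemma dom_main_conic x y (t : R) : 0 < t ->
  dom_main f c U p q (x, y) -> dom_main f c U p q (x, t *: y).
Proof.
move=> t0; rewrite (dom_mainE c p q f_pos) => -[/= Ux h u0 N0].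
have tn0 : t != 0 by rewrite gt_eqF.
split=> //=; rewrite ?phiZ ?redNZ// ?mxE ?mulf_neq0 ?expf_neq0//.
by rewrite mulr_gt0 ?exprn_gt0.
Qed.

Lemma F_main_homog x y (t : R) : Delta p q != 0 -> 0 < t ->
  dom_main f c U p q (x, y) ->
  F_main f c p q (x, t *: y) = t * F_main f c p q (x, y).
Proof.
move=> D0 t0 Dy; rewrite !F_mainE//; last exact: dom_main_conic.
have tn0 : t != 0 by rewrite gt_eqF.
rewrite redNZ// radZ//= !mxE normrM sqrtrM// ger0_norm ?sqr_ge0// sqrtr_sqr.
by rewrite (gtr0_norm t0) -mulf_div divff// mul1r; ring.
Qed.

(** Writing F as f exp (ln |N| / 2 + T(s / u)), the half of dN / N and the
    contribution - p (u ds - s du) / (2 N) of the profile add up to m / N. *)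
Lemma F_main_dlog z : Delta p q != 0 -> dom_main f c U p q z ->
  is_diff z (F_main f c p q)
    (fun v => F_main f c p q z * (tau f z * v.1 0 ord0 + m z v.2 / N z)).
Proof.
move=> D0 Dz.
have FE y : dom_main f c U p q y -> f (x1 y.1) *
    expR (2^-1 * ln `|N y| + profile p q (s y / u y)) = F_main f c p q y.
  move=> Dy; rewrite F_mainE// expRD; congr (_ * (_ * _)).
  move: Dy; rewrite (dom_mainE c p q f_pos) => -[_ _ _ N0].
  have N0' : 0 < `|N y| by rewrite normr_gt0.
  by rewrite -powR12_sqrt ?(ltW N0')// /powR gt_eqF.
have := FE z Dz; move: (Dz).
rewrite {1}(dom_mainE c p q f_pos) => -[Uz h u0 N0] FzE.
have f0 : f (x1 z.1) != 0 by rewrite gt_eqF// f_pos.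
have s0 := rad_neq0 h.
have dN := is_diff_chain (is_diff_redN p q c_sym h) (is_derive_ln_abs N0).
have t0 : (s z / u z) ^+ 2 + p * (s z / u z) + (1 + q) != 0.
  rewrite (_ : _ + _ = N z / u z ^+ 2); last by rewrite /redN (rad_sq h); field.
  by rewrite mulf_neq0// invr_neq0// expf_neq0.
have dT := is_diff_chain (is_diff_mul (is_diff_rad c_sym h)
  (is_diff_inv u0 (is_diff_y ord0 z))) (is_derive_profile D0 t0).
have H := is_diff_mul (is_diff_f f_smooth Uz)
  (is_diff_chain (is_diff_add (is_diff_mul (is_diff_const 2^-1 z) dN) dT)
     (is_derive_expR _)).
have near_F : \near z, f (x1 z.1) *
    expR (2^-1 * ln `|N z| + profile p q (s z / u z)) = F_main f c p q z.
  exact: open_near (open_dom_main hU f_pos c_sym) Dz FE.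
apply: is_diff_ext (near_eq_is_diff near_F H) _ _ => // v /=.
rewrite -FzE /tau /redm.
have -> : (s z / u z) ^+ 2 + p * (s z / u z) + (1 + q) = N z / u z ^+ 2.
  by rewrite /redN (rad_sq h); field.
by field; rewrite f0 s0 u0 N0.
Qed.

Section Degenerate.
Local Notation a := (p / 2).
Hypothesis D0 : Delta p q = 0.

Lemma Delta0_q : q = a ^+ 2 - 1.
Proof.
by move: D0; rewrite /Delta (_ : a ^+ 2 = p ^+ 2 / 4); [lra|field].
Qed.

(** The quadratic form N is a perfect square exactly when Delta = 0, whence the
    rational exponent in place of a logarithm or an arctangent. *)
Lemma redN_sq z : 0 < phi c z.2 -> N z = (a * u z + s z) ^+ 2.
Proof. by move=> h; rewrite /redN (rad_sq h) {1}Delta0_q; field. Qed.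

Lemma F_degenE z : dom_degen f c U a z -> F_degen f c a z =
  f (x1 z.1) * ((a * u z + s z) * expR (a * u z / (a * u z + s z))).
Proof.
rewrite (dom_degenE c a f_pos) => -[Uz h b0].
have f0 : f (x1 z.1) != 0 by rewrite gt_eqF// f_pos.
rewrite /F_degen (wE f_pos Uz h) /beta.
have -> : a * (f (x1 z.1) * u z) + f (x1 z.1) * s z =
  f (x1 z.1) * (a * u z + s z) by ring.
by rewrite mulrCA -mulf_div divff// mul1r -mulrA.
Qed.

Lemma F_degen_neq0 z : dom_degen f c U a z -> F_degen f c a z != 0.
Proof.
move=> Dz; rewrite F_degenE//.
move: Dz; rewrite (dom_degenE c a f_pos) => -[Uz h b0].
by rewrite !mulf_neq0// gt_eqF ?expR_gt0 ?f_pos.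
Qed.

Lemma dom_degen_conic x y (t : R) : 0 < t ->
  dom_degen f c U a (x, y) -> dom_degen f c U a (x, t *: y).
Proof.
move=> t0; rewrite (dom_degenE c a f_pos) => -[/= Ux h b0].
split => //=; first by rewrite phiZ mulr_gt0 ?exprn_gt0.
by rewrite radZ// mxE mulrCA -mulrDr mulf_neq0// gt_eqF.
Qed.

Lemma F_degen_homog x y (t : R) : 0 < t -> dom_degen f c U a (x, y) ->
  F_degen f c a (x, t *: y) = t * F_degen f c a (x, y).
Proof.
move=> t0 Dy; rewrite !F_degenE//; last exact: dom_degen_conic.
have tn0 : t != 0 by rewrite gt_eqF.
rewrite radZ//= mxE (mulrCA a t) -mulrDr -mulf_div divff// mul1r; ring.
Qed.

Lemma F_degen_dlog z : dom_degen f c U a z ->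
  is_diff z (F_degen f c a)
    (fun v => F_degen f c a z * (tau f z * v.1 0 ord0 + m z v.2 / N z)).
Proof.
move=> Dz; have FzE := F_degenE Dz; move: (Dz).
rewrite {1}(dom_degenE c a f_pos) => -[Uz h b0].
have f0 : f (x1 z.1) != 0 by rewrite gt_eqF// f_pos.
have s0 := rad_neq0 h.
have dau := is_diff_mul (is_diff_const a z) (is_diff_y ord0 z).
have db := is_diff_add dau (is_diff_rad c_sym h).
have H := is_diff_mul (is_diff_f f_smooth Uz) (is_diff_mul db
  (is_diff_chain (is_diff_mul dau
      (is_diff_inv (f := fun z => a * u z + s z) b0 db))
     (is_derive_expR _))).
pose G (y : V * V) := f (x1 y.1) * ((a * u y + s y) *
  expR (a * u y / (a * u y + s y))).
have near_F : \near z, G z = F_degen f c a z.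
  apply: open_near (open_dom_degen (a := a) hU f_pos c_sym) Dz _ => y Dy.
  by rewrite F_degenE.
apply: is_diff_ext (near_eq_is_diff near_F H) _ _ => // v /=.
rewrite FzE redN_sq// /tau /redm Delta0_q.
have b1 : p * u z + s z * 2 != 0.
  by rewrite (_ : _ + _ = 2 * (a * u z + s z)) ?mulf_neq0//; field.
by field; rewrite f0 s0 b1.
Qed.

End Degenerate.

End FundamentalFunctions.

Theorem theorem4p11 (R : realType) (n : nat) (hn : (3 <= n.+1)%N)
  (U : set 'rV[R]_n.+1) (hU : open U)
  (f : R -> R)
  (f_smooth : smooth_on (@x1 R n @` U) f)
  (f_pos : forall x, U x -> 0 < f (x1 x))
  (f_nconst : exists2 x, U x & derive1 f (x1 x) != 0)
  (c : 'M[R]_n) (c_sym : c^T = c) (c_nonsing : c \in unitmx)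
  (c_dom : exists y : 'rV[R]_n.+1, 0 < phi c y)
  (p q : R) (hp : p != 0) (hq : q != -1) :
  (Delta p q != 0 ->
     [/\ metrizable_by (dom_main f c U p q) (S_coef f c p q) (F_main f c p q),
         landsberg (dom_main f c U p q) (F_main f c p q) &
         ~ berwald (dom_main f c U p q) (F_main f c p q)]) /\
  (Delta p q = 0 ->
     q = (p / 2) ^+ 2 - 1 /\
     metrizable_by (dom_degen f c U (p / 2)) (S_coef f c p q)
       (F_degen f c (p / 2))).
Proof.
have q1 : 1 + q != 0 by rewrite addrC addr_eq0.
have [x0 Ux0 f'0] := f_nconst.
have [y0 [phi0 u0 N0]] := regular_direction x0 hp q1 c_dom.
split=> [D0|D0].
- have DP z : dom_main f c U p q z ->
      [/\ U z.1, 0 < phi c z.2 & redN c p q z != 0].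
    by rewrite (dom_mainE c p q f_pos) => -[].
  have D00 : dom_main f c U p q (x0, y0) by rewrite (dom_mainE c p q f_pos).
  have Do := open_dom_main (p := p) (q := q) hU f_pos c_sym.
  have dF z := @F_main_dlog _ _ _ _ _ _ _ hU f_smooth f_pos c_sym z D0.
  have F0 z (Dz : dom_main f c U p q z) := F_main_neq0 f_pos Dz D0.
  have DU z : dom_main f c U p q z -> U z.1 by case/DP.
  have Dphi z : dom_main f c U p q z -> 0 < phi c z.2 by case/DP.
  have DN z : dom_main f c U p q z -> redN c p q z != 0 by case/DP.
  split.
  + apply: dlog_metrizable => //; first by exists (x0, y0).
      by move=> x y t; exact: dom_main_conic.
    by move=> x y t; exact: F_main_homog.
  + exact: (dlog_landsberg f_smooth f_pos c_sym c_nonsing q1 Do DU Dphi DN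
      F0 dF).
  + exact: (dlog_not_berwald f_smooth f_pos c_sym c_nonsing q1 Do DU Dphi DN
      F0 dF hn hp D00).
- split; first exact: Delta0_q.
  have DP z : dom_degen f c U (p / 2) z ->
      [/\ U z.1, 0 < phi c z.2 & redN c p q z != 0].
    rewrite (dom_degenE c _ f_pos) => -[Uz h b0].
    by split; rewrite ?redN_sq ?expf_neq0.
  have D00 : dom_degen f c U (p / 2) (x0, y0).
    rewrite (dom_degenE c _ f_pos); split => //.
    by move: N0; rewrite redN_sq// expf_eq0.
  apply: dlog_metrizable => //.
  + exact: open_dom_degen.
  + by exists (x0, y0).
  + by move=> x y t; exact: dom_degen_conic.
  + by move=> x y t; exact: F_degen_homog.
  + by move=> z; exact: F_degen_neq0.
  + by move=> z; exact: F_degen_dlog.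
Qed.
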